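(* Let $K$ be an algebraically closed field of characteristic zero. The maximal (Waring) rank of ternary (plane) quartics over $K$ is seven. That is, every homogeneous polynomial $f$ of degree $4$ in three variables over $K$ satisfies $\operatorname{rk} f\le 7$, and there exists a homogeneous polynomial of degree $4$ in three variables over $K$ whose rank is exactly $7$.
   Context: The (Waring) rank $\operatorname{rk} f$ of a homogeneous polynomial $f$ of degree $d$ over $K$ is the minimum number $r$ of summands needed to write $f=\ell_1^d+\cdots+\ell_r^d$ as a sum of $d$-th powers of linear forms $\ell_1,\dots,\ell_r$ (with $\operatorname{rk} 0=0$). *)

(* Defs.v *)
From mathcomp Require Import all_boot all_algebra mpoly.
Set Implicit Arguments.
Unset Strict Implicit.
Unset Printing Implicit Defensive.

Import GRing.Theory.
Local Open Scope ring_scope.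

Definition sum_of_powers (K : fieldType) (n d r : nat) (f : {mpoly K[n]}) : Prop :=
  exists l : 'I_r -> {mpoly K[n]},
    (forall i, l i \is 1.-homog) /\ f = \sum_(i < r) l i ^+ d.

(* The rank is given by its graph, [rk f = r], since over a general field a
   form need not be a sum of d-th powers of linear forms.  The degree d is
   explicit because the zero polynomial is homogeneous of every degree. *)
Definition waring_rank (K : fieldType) (n d : nat) (f : {mpoly K[n]}) (r : nat) : Prop :=
  sum_of_powers d r f /\ forall s : nat, sum_of_powers d s f -> (r <= s)%N.

(* Main.v *)
(* Write a quartic f as a sum of w (p . x)^4 over finitely many weighted points
   p, so that contracting f with a dual quartic G is a weighted sum of the
   values G(p).  A dual conic is apolar to f if its products with all conics
   contract f to 0; the apolar conics form the kernel of the 6 x 6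
   catalecticant C.

   Upper bound.  If a product of two distinct lines is apolar, f is a sum of
   two binary quartics sharing one variable z; moving a generic multiple of z^4
   between them gives rank at most 3 + 3, except for a summand z^3 l, and at
   most 7 in any case.  If a double line is apolar, one power can be removed so
   that the rest has an apolar pair of lines or lies on a conic.  If the kernel
   of C is spanned by a smooth conic, f is a binary octic with invertible Hankel
   matrix, of rank 5 by Sylvester's method.  If the kernel contains a smooth
   conic and another one, it contains a product of lines.  If C is invertible,
   there is for each p a unique conic Q_p contracting f to p^2, and if
   Q_p(p) <> 0 then f minus a multiple of p^4 has kernel spanned by Q_p.  The
   trace of C^-1 C shows that Q_p(p) is not identically 0, and p can be chosen
   such that Q_p is moreover not the square of a line; the rank of the rest is
   then at most 6.

   Lower bound.  For 6 x^2 y^2 + 4 y^3 z the apolar conics are spanned by z^2,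
   xz and x^2 - yz.  If it is a sum of at most six fourth powers, counting ranks
   shows that some apolar conic vanishes at all the points; both on an
   irreducible conic and on the union of two lines a Vandermonde argument then
   requires seven points. *)
Require Import Defs.
From mathcomp Require Import all_boot all_algebra mpoly.
From mathcomp Require Import all_field ring.
From Stdlib Require Import Classical.
Set Implicit Arguments.
Unset Strict Implicit.
Unset Printing Implicit Defensive.
Import GRing.Theory.
Local Open Scope ring_scope.

(** * Moment functionals and binary quartics *)

(** The linear functional sending ['X^i] to [c i]. A binary form is encoded by its moments [c]; a
    polynomial is apolar to it when its multiples, up to the right degree, are sent to 0. *)
Definition mfun (R : nzRingType) (c : nat -> R) (p : {poly R}) : R :=
  \sum_(i < size p) p`_i * c i.

Section MomentFunctional.
Variable R : comNzRingType.
Implicit Types (c : nat -> R) (p q : {poly R}).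

Lemma mfun_wide c p m : (size p <= m)%N -> mfun c p = \sum_(i < m) p`_i * c i.
Proof.
move=> le_pm; rewrite /mfun -(subnKC le_pm) big_split_ord /=.
rewrite [X in _ = _ + X]big1 ?addr0 // => i _.
by rewrite nth_default ?mul0r // leq_addr.
Qed.

Lemma mfunD c p q : mfun c (p + q) = mfun c p + mfun c q.
Proof.
have le_p := leq_maxl (size p) (size q); have le_q := leq_maxr (size p) (size q).
rewrite (mfun_wide _ le_p) (mfun_wide _ le_q).
rewrite (mfun_wide _ (leq_trans (size_polyD p q) (leqnn _))) -big_split /=.
by apply: eq_bigr => i _; rewrite coefD mulrDl.
Qed.

Lemma mfunZ c a p : mfun c (a *: p) = a * mfun c p.
Proof.
rewrite (mfun_wide _ (size_scale_leq a p)) mulr_sumr.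
by apply: eq_bigr => i _; rewrite coefZ mulrA.
Qed.

Lemma mfunB c p q : mfun c (p - q) = mfun c p - mfun c q.
Proof. by rewrite mfunD -scaleN1r mfunZ mulN1r. Qed.

Lemma mfunXn c j : mfun c 'X^j = c j.
Proof.
rewrite /mfun size_polyXn big_ord_recr /= big1 ?add0r => [|i _].
  by rewrite coefXn eqxx mul1r.
by rewrite coefXn (ltn_eqF (ltn_ord i)) mul0r.
Qed.

Lemma mfunMX c p : mfun c (p * 'X) = mfun (fun i => c i.+1) p.
Proof.
have le_pX : (size (p * 'X)%R <= (size p).+1)%N.
  by apply: leq_trans (size_polyMleq _ _) _; rewrite size_polyX addn2.
rewrite (mfun_wide _ le_pX) big_ord_recl coefMX mul0r add0r.
by apply: eq_bigr => i _; rewrite coefMX.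
Qed.

Lemma mfunMXn c p k : mfun c (p * 'X^k) = mfun (fun i => c (i + k)%N) p.
Proof.
elim: k c p => [|k IHk] c p.
  by rewrite mulr1; apply: eq_bigr => i _; rewrite addn0.
by rewrite exprS mulrA IHk mfunMX; apply: eq_bigr => i _; rewrite addSnnS.
Qed.

Lemma mfun_seqD c1 c2 p : mfun (fun i => c1 i + c2 i) p = mfun c1 p + mfun c2 p.
Proof. by rewrite /mfun -big_split; apply: eq_bigr => i _; rewrite mulrDr. Qed.

Lemma mfun_seqZ a c p : mfun (fun i => a * c i) p = a * mfun c p.
Proof. by rewrite /mfun mulr_sumr; apply: eq_bigr => i _; rewrite mulrCA. Qed.

Lemma mfunMXsubC c p r :
  mfun c (p * ('X - r%:P)) = mfun (fun i => c i.+1 + (- r) * c i) p.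
Proof.
by rewrite mulrBr mfunB mfunMX (mulrC p) mul_polyC mfunZ mfun_seqD mfun_seqZ mulNr.
Qed.

End MomentFunctional.

Definition psum (K : nzRingType) (t : seq (K * K)) (i : nat) : K :=
  \sum_(w <- t) w.1 * w.2 ^+ i.

(** * Sylvester's decomposition along distinct roots *)

Section Sylvester.
Variable K : fieldType.
Implicit Types (c : nat -> K) (p q h : {poly K}).

(** Induction on [rs]: splitting off the factor ['X - r%:P] replaces [c i] by [c i.+1 - r * c i], a
    sequence apolar to the product over the remaining roots. *)
Lemma psum_of_apolar (rs : seq K) : uniq rs -> forall c M,
    (forall j, (j < M)%N -> mfun c (\prod_(r <- rs) ('X - r%:P) * 'X^j) = 0) ->
  exists2 t : seq (K * K), map snd t = rs &
    forall i, (i < size rs + M)%N -> c i = psum t i.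
Proof.
elim: rs => [_ c M cM | r rs IH /= /andP[r_rs rs_uniq] c M cM].
  exists [::] => // i lt_iM.
  by rewrite /psum big_nil -(cM i) // big_nil mul1r mfunXn.
have [j /cM | t def_rs ct] := IH rs_uniq (fun i => c i.+1 + (- r) * c i) M.
  by rewrite big_cons mulrC mulrCA mulrC mfunMXsubC mulrC.
(* The recurrence [c i.+1 = r * c i + psum t i] has a particular solution with weights
   [w.1 / (w.2 - r)]; the weight of [r] corrects the value at 0. *)
pose a := \sum_(w <- t) w.1 / (w.2 - r).
exists ((c 0%N - a, r) :: [seq (w.1 / (w.2 - r), w.2) | w <- t]).
  by rewrite /= -map_comp def_rs.
have neq_r w : w \in t -> w.2 - r != 0.
  move=> t_w; rewrite subr_eq0; apply: contraNneq r_rs => <-.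
  by rewrite -def_rs map_f.
elim=> [_|i IHi lt_i].
  rewrite /psum big_cons big_map /= expr0 mulr1 /a.
  by under [X in _ = _ + X]eq_bigr do rewrite expr0 mulr1; rewrite subrK.
have -> : c i.+1 = (c i.+1 + - r * c i) + r * c i by ring.
rewrite ct // IHi ?(ltnW lt_i) // /psum !big_cons !big_map /=.
rewrite mulrDr addrCA exprS mulrCA; congr (_ + _).
rewrite mulr_sumr -big_split /= big_seq_cond [RHS]big_seq_cond.
apply: eq_bigr => w /andP[t_w _]; rewrite exprS.
by field; apply: neq_r.
Qed.

End Sylvester.

(** * Binary forms with invertible Hankel matrix *)

Section HankelInvertible.
Variable K : closedFieldType.
Hypothesis charK0 : [pchar K] =i pred0.
Implicit Types (c : nat -> K) (p q h : {poly K}).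

Lemma coprimep_noroot p q :
  p != 0 -> (forall x, root p x -> ~~ root q x) -> coprimep p q.
Proof.
move=> nz_p no_root; rewrite /coprimep; apply/negbNE/closed_rootP => -[x].
by rewrite root_gcd => /andP[/no_root/negbTE->].
Qed.

Lemma deriv_neq0 p : (1 < size p)%N -> p^`() != 0.
Proof.
move=> p_gt1; apply: contraTneq p_gt1 => p'0; rewrite -leqNgt.
apply/leq_sizeP => -[//|j] _; have /eqP := coef_deriv p j.
rewrite p'0 coef0 eq_sym -mulr_natl mulf_eq0.
by move/pcharf0P: charK0 => -> /= /eqP.
Qed.

(* If [h2 + t h1] has a double root [r], then the Wronskian of [h1] and [h2]
   vanishes at [r]; this excludes finitely many values of [t] only. *)
Lemma squarefree_in_pencil n h1 h2 :
    h2 \is monic -> size h2 = n.+2 -> h1 != 0 -> (size h1 <= n.+1)%N ->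
    (forall x, ~~ (root h1 x && root h2 x)) ->
  exists t, exists2 rs : seq K,
    uniq rs & size rs = n.+1 /\ h2 + t *: h1 = \prod_(r <- rs) ('X - r%:P).
Proof.
move=> mon2 sz2 nz1 sz1 no_root.
have nz2 : h2 != 0 by rewrite monic_neq0.
pose W := h1^`() * h2 - h1 * h2^`().
have nzW : W != 0.
  (* If [W = 0], then [h2], being coprime to [h1], divides its own derivative, which has smaller
     degree. *)
  apply: contraTneq isT => /eqP; rewrite subr_eq0 => /eqP eqW.
  have : h2 %| h1 * h2^`() by rewrite -eqW dvdp_mulIr.
  rewrite Gauss_dvdpr; last first.
    apply: coprimep_noroot => // x root2.
    by have := no_root x; rewrite root2 andbT.
  move/dvdp_leq; rewrite deriv_neq0 ?sz2 // => /(_ isT); rewrite -sz2.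
  by rewrite leqNgt lt_size_deriv.
have [ws defW] := closed_field_poly_normal W.
have rootW x : root W x = (x \in ws).
  by rewrite defW rootZ ?lead_coef_eq0 // root_prod_XsubC.
(* As a polynomial in [t], this vanishes exactly when [h2 + t *: h1] shares a root with [W]. *)
pose P := \prod_(r <- ws) (h2.[r]%:P + h1.[r] *: 'X).
have /closed_nonrootP[t Pt] : P != 0.
  rewrite prodf_seq_neq0; apply/allP => r _ /=.
  apply: contraNneq (no_root r) => /polyP eq0.
  have := eq0 0%N; have := eq0 1%N.
  rewrite !coefD !coefZ !coefC !coefX /= !mulr1 mulr0 addr0 add0r.
  by rewrite !rootE => -> ->; rewrite !eqxx.
have {}Pt r : r \in ws -> h2.[r] + t * h1.[r] != 0.
  move=> ws_r; apply: contraNneq Pt => eq0.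
  rewrite /root /P horner_prod prodf_seq_eq0.
  by apply/hasP; exists r => //=;
     rewrite !hornerE mulrC eq0.
exists t; pose p := h2 + t *: h1.
have sz_t : (size (t *: h1) < size h2)%N.
  by rewrite sz2 ltnS (leq_trans (size_scale_leq _ _)).
have sz_p : size p = n.+2 by rewrite size_polyDl.
have [rs defp] := closed_field_poly_normal p.
have lead_p : lead_coef p = 1 by rewrite lead_coefDl // (eqP mon2).
rewrite lead_p scale1r in defp.
exists rs; last first.
  by split; last exact: defp; move: sz_p; rewrite defp size_prod_XsubC => -[].
rewrite -separable_prod_XsubC -defp unlock.
have nz_p : p != 0 by rewrite -size_poly_eq0 sz_p.
apply: coprimep_noroot => // r /eqP pr0; apply/negP => /eqP p'r0.
have /Pt : r \in ws.
  rewrite -rootW rootE /W; move: pr0 p'r0.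
  rewrite /p derivD derivZ !hornerE => pr0 p'r0.
  have -> : h2.[r] = - (t * h1.[r]) by apply/eqP; rewrite -subr_eq0 opprK pr0.
  have -> : h2^`().[r] = - (t * h1^`().[r]).
    by apply/eqP; rewrite -subr_eq0 opprK p'r0.
  by apply/eqP; ring.
by move: pr0; rewrite /p !hornerE => ->; rewrite eqxx.
Qed.

(** By hypothesis the Hankel matrix with entries [c (i + j)] has trivial kernel, hence is
    invertible. *)
Lemma hankel_solve n c :
    (forall h : {poly K}, (size h <= n.+1)%N ->
       (forall j, (j <= n)%N -> mfun c (h * 'X^j) = 0) -> h = 0) ->
  forall b : nat -> K, exists2 h : {poly K}, (size h <= n.+1)%N &
    forall j, (j <= n)%N -> mfun c (h * 'X^j) = b j.
Proof.
move=> c_inj b; pose H := \matrix_(i < n.+1, j < n.+1) c (i + j)%N.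
have HE (v : 'rV_n.+1) (j : 'I_n.+1) : mfun c (rVpoly v * 'X^j) = (v *m H) 0 j.
  rewrite mfunMXn (mfun_wide _ (size_poly _ _)) mxE.
  by apply: eq_bigr => i _; rewrite coef_rVpoly_ord mxE.
have uH : H \in unitmx.
  rewrite -row_free_unit; apply/row_freeP.
  have /eqP kerH : kermx H == 0.
    apply/rowV0P => v /sub_kermxP vH0.
    have /c_inj v0 : (size (rVpoly v) <= n.+1)%N by apply: size_poly.
    rewrite -(rVpolyK v) v0 ?linear0 // => j le_jn.
    by have := HE v (Ordinal (le_jn : j < n.+1)%N); rewrite vH0 mxE.
  by apply/row_freeP; rewrite -kermx_eq0 kerH.
exists (rVpoly (\row_(j < n.+1) b j *m invmx H)); first exact: size_poly.
move=> j le_jn; have := HE (\row_(j < n.+1) b j *m invmx H) (Ordinal (le_jn : j < n.+1)%N).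
by rewrite mulmxKV // mxE.
Qed.

(** The apolar polynomials of degree at most [n.+1] include a pencil spanned by some [h1] of degree
    at most [n] and a monic [h2] of degree [n.+1]. The two have no common root, so some member has
    distinct roots, which serve as points. *)
Lemma psum_of_hankel n c :
    (forall h : {poly K}, (size h <= n.+1)%N ->
       (forall j, (j <= n)%N -> mfun c (h * 'X^j) = 0) -> h = 0) ->
  exists2 t : seq (K * K), (size t <= n.+1)%N &
    forall i, (i <= n.*2)%N -> c i = psum t i.
Proof.
move=> c_inj; have solve := hankel_solve c_inj.
have [h1 sz1 h1E] := solve (fun j => (j == n)%:R).
have [e sze eE] := solve (fun j => c (n.+1 + j)%N).
pose h2 := 'X^(n.+1) - e.
have sz2 : size h2 = n.+2 by rewrite size_polyDl size_polyXn // size_polyN.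
have mon2 : h2 \is monic.
  by rewrite monicE lead_coefDl ?lead_coefXn // size_polyXn size_polyN.
have h2E j : (j <= n)%N -> mfun c (h2 * 'X^j) = 0.
  by move=> le_jn; rewrite mulrBl mfunB eE // -exprD mfunXn subrr.
have h1E0 j : (j < n)%N -> mfun c (h1 * 'X^j) = 0.
  by move=> lt_jn; rewrite h1E ?(ltnW lt_jn) // ltn_eqF.
have nz1 : h1 != 0.
  apply: contraTneq (oner_neq0 K) => h10; rewrite negbK eq_sym.
  by have := h1E n (leqnn n); rewrite h10 mul0r eqxx /mfun size_poly0 big_ord0 => /eqP.
have no_root x : ~~ (root h1 x && root h2 x).
  apply/negP => /andP[/factor_theorem[k1 def1] /factor_theorem[k2 def2]].
  have nzk1 : k1 != 0 by apply: contraNneq nz1 => k10; rewrite def1 k10 mul0r.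
  have szk1 : (size k1 <= n)%N.
    by move: sz1; rewrite def1 size_Mmonic ?monicXsubC // size_XsubC addn2.
  have nzk2 : k2 != 0 by apply: contra_eq_neq sz2 => k20; rewrite def2 k20 mul0r size_poly0.
  have szk2 : size k2 = n.+1.
    by move: sz2; rewrite def2 size_Mmonic ?monicXsubC // size_XsubC addn2 => -[].
  (* For cofactors of a common root [x]: a combination [k] that [mfun c] sends to 0 is orthogonal to
     every ['X^j] with [j <= n], by induction on [j], so it is 0. *)
  have kill (k : {poly K}) : (size k <= n.+1)%N -> mfun c k = 0 ->
      (forall j, (j < n)%N -> mfun c (k * ('X - x%:P) * 'X^j) = 0) -> k = 0.
    move=> szk k0 kX; apply: c_inj => // j; elim: j => [|j IHj] lt_jn.
      by rewrite mulr1.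
    have := kX j lt_jn; rewrite mulrBr mulrBl mfunB -mulrA -exprS.
    rewrite (mulrC k x%:P) mul_polyC -scalerAl mfunZ IHj ?(ltnW lt_jn) //.
    by rewrite mulr0 subr0.
  have [m1 | m1] := eqVneq (mfun c k1) 0.
    move: nzk1; rewrite (kill k1) ?eqxx // ?(leq_trans szk1) // => j lt_jn.
    by rewrite -def1 h1E0.
  pose k := k2 - (mfun c k2 / mfun c k1) *: k1.
  have szk : size k = n.+1.
    by rewrite size_polyDl szk2 // size_polyN ltnS (leq_trans (size_scale_leq _ _)).
  suff k0 : k = 0 by rewrite k0 size_poly0 in szk.
  apply: kill => [||j lt_jn]; first by rewrite szk.
    by rewrite /k mfunB mfunZ divfK // subrr.
  rewrite /k !mulrBl mfunB -def2 h2E ?(ltnW lt_jn) //.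
  by rewrite -!scalerAl mfunZ -def1 h1E0 // mulr0 subrr.
have [t [rs rs_uniq [sz_rs def_p]]] := squarefree_in_pencil mon2 sz2 nz1 sz1 no_root.
have [j lt_jn | s def_rs cs] := psum_of_apolar rs_uniq (c := c) (M := n).
  by rewrite -def_p mulrDl mfunD -scalerAl mfunZ h2E ?(ltnW lt_jn) // h1E0 // mulr0 addr0.
exists s; first by rewrite -(size_map snd) def_rs sz_rs.
by move=> i le_i; apply: cs; rewrite sz_rs addSn ltnS addnn.
Qed.

End HankelInvertible.

(** * Ranks of binary quartics *)

Section BinaryQuartics.
Variable K : closedFieldType.
Hypothesis charK0 : [pchar K] =i pred0.

Definition bsum (t : seq (K * (K * K))) (i j : nat) : K :=
  \sum_(w <- t) w.1 * (w.2.1 ^+ i * w.2.2 ^+ j).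

(** The quartic is the sum of the terms binomial(4, i) m_i x^i z^(4-i). *)
Definition brank_le r (m0 m1 m2 m3 m4 : K) :=
  exists2 t, (size t <= r)%N &
    [/\ bsum t 0 4 = m0, bsum t 1 3 = m1, bsum t 2 2 = m2, bsum t 3 1 = m3
      & bsum t 4 0 = m4].

Lemma brank3_of_hankel (m0 m1 m2 m3 m4 : K) :
    m0 * (m2 * m4 - m3 ^+ 2) - m1 * (m1 * m4 - m2 * m3) + m2 * (m1 * m3 - m2 ^+ 2) != 0 ->
  brank_le 3 m0 m1 m2 m3 m4.
Proof.
set D := (X in X != 0) => nzD.
pose c := nth 0 [:: m0; m1; m2; m3; m4].
have [h sz_h hc | t sz_t ct] := @psum_of_hankel _ charK0 2 c.
  have hE j : (j <= 2)%N -> h`_0 * c j + h`_1 * c j.+1 + h`_2 * c j.+2 = 0.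
    move=> /hc; rewrite mfunMXn (mfun_wide _ sz_h) !big_ord_recl big_ord0 /=.
    by rewrite addr0 !add0n addrA.
  have := hE 2%N isT; have := hE 1%N isT; have := hE 0%N isT; rewrite /c /= => E0 E1 E2.
  (* Cramer's rule: [D] times each coefficient of [h] is a combination of the three equations, with
     cofactors as coefficients. *)
  have h0 : h`_0 = 0.
    apply/eqP; move: (mulf_eq0 h`_0 D); rewrite (negbTE nzD) orbF => <-; apply/eqP.
    transitivity ((h`_0 * m0 + h`_1 * m1 + h`_2 * m2) * (m2 * m4 - m3 ^+ 2)
      - (h`_0 * m1 + h`_1 * m2 + h`_2 * m3) * (m1 * m4 - m2 * m3)
      + (h`_0 * m2 + h`_1 * m3 + h`_2 * m4) * (m1 * m3 - m2 ^+ 2)); first by rewrite /D; ring.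
    by rewrite E0 E1 E2; ring.
  have h1 : h`_1 = 0.
    apply/eqP; move: (mulf_eq0 h`_1 D); rewrite (negbTE nzD) orbF => <-; apply/eqP.
    transitivity (- (h`_0 * m0 + h`_1 * m1 + h`_2 * m2) * (m1 * m4 - m2 * m3)
      + (h`_0 * m1 + h`_1 * m2 + h`_2 * m3) * (m0 * m4 - m2 ^+ 2)
      - (h`_0 * m2 + h`_1 * m3 + h`_2 * m4) * (m0 * m3 - m1 * m2)); first by rewrite /D; ring.
    by rewrite E0 E1 E2; ring.
  have h2 : h`_2 = 0.
    apply/eqP; move: (mulf_eq0 h`_2 D); rewrite (negbTE nzD) orbF => <-; apply/eqP.
    transitivity ((h`_0 * m0 + h`_1 * m1 + h`_2 * m2) * (m1 * m3 - m2 ^+ 2)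
      - (h`_0 * m1 + h`_1 * m2 + h`_2 * m3) * (m0 * m3 - m1 * m2)
      + (h`_0 * m2 + h`_1 * m3 + h`_2 * m4) * (m0 * m2 - m1 ^+ 2)); first by rewrite /D; ring.
    by rewrite E0 E1 E2; ring.
  apply/polyP => -[|[|[|i]]]; rewrite coef0 //.
  by rewrite nth_default // (leq_trans sz_h).
exists [seq (w.1, (w.2, 1)) | w <- t]; first by rewrite size_map.
have bE i : (i <= 4)%N -> bsum [seq (w.1, (w.2, 1)) | w <- t] i (4 - i) = c i.
  move=> /ct ->; rewrite /bsum big_map; apply: eq_bigr => w _ /=.
  by rewrite expr1n mulr1.
by split; [exact: (bE 0%N) | exact: (bE 1%N) | exact: (bE 2%N) |
           exact: (bE 3%N) | exact: (bE 4%N)].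
Qed.

(* Adding a multiple of [z^4] to a binary quartic changes only [m0]; the
   excluded form [m2 = m3 = m4 = 0] is [z^3] times a linear form. *)
Lemma brank3_generic (m1 m2 m3 m4 : K) :
    ~ [/\ m2 = 0, m3 = 0 & m4 = 0] ->
  exists a, forall m0, m0 != a -> brank_le 3 m0 m1 m2 m3 m4.
Proof.
(* The Hankel determinant is [m0 * d + e]; unless [d] and [e] both vanish, it is nonzero for all but
   at most one [m0]. *)
move=> nz_m; set d := m2 * m4 - m3 ^+ 2.
set e := - m1 * (m1 * m4 - m2 * m3) + m2 * (m1 * m3 - m2 ^+ 2).
have [d0 | nz_d] := eqVneq d 0; last first.
  exists (- e / d) => m0 neq_m0; apply: brank3_of_hankel.
  apply: contraNneq neq_m0 => D0; rewrite -subr_eq0.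
  suff -> : m0 - - e / d = 0 by [].
  by apply: (mulIf nz_d); rewrite mul0r -D0 /e /d; field.
have [e0 | nz_e] := eqVneq e 0; last first.
  exists 0 => m0 _; apply: brank3_of_hankel.
  suff -> : m0 * (m2 * m4 - m3 ^+ 2) - m1 * (m1 * m4 - m2 * m3) +
    m2 * (m1 * m3 - m2 ^+ 2) = m0 * d + e by rewrite d0 mulr0 add0r.
  by rewrite /d /e; ring.
exists 0 => m0 _.
have [m40 | nz_m4] := eqVneq m4 0.
  have m30 : m3 = 0.
    apply/eqP; rewrite -sqrf_eq0 -oppr_eq0.
    by move: d0; rewrite /d m40 mulr0 sub0r => ->.
  have m20 : m2 = 0.
    apply/eqP; have : m2 ^+ 3 == 0 by rewrite -oppr_eq0 -e0 /e m40 m30; apply/eqP; ring.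
    by rewrite expf_eq0.
  by case: nz_m.
(* Now [m1], ..., [m4] are the moments of a single point, and a multiple of z^4 adjusts [m0]. *)
have m2E : m2 = m3 ^+ 2 / m4.
  by apply: (mulIf nz_m4); rewrite divfK //; apply/eqP; rewrite -subr_eq0 -/d d0.
have m1E : m1 = m3 ^+ 3 / m4 ^+ 2.
  apply/eqP; rewrite -subr_eq0 -sqrf_eq0; apply/eqP; apply: (mulfI nz_m4).
  by rewrite mulr0 -[RHS]oppr0 -e0 /e m2E; field.
have [m30 | nz_m3] := eqVneq m3 0.
  exists [:: (m0, (0, 1)); (m4, (1, 0))] => //.
  rewrite /bsum !big_cons !big_nil /= m1E m2E m30.
  by split; ring.
exists [:: (m0 - m3 ^+ 4 / m4 ^+ 3, (0, 1)); (m3 ^+ 4 / m4 ^+ 3, (m4 / m3, 1))] => //.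
rewrite /bsum !big_cons !big_nil /= m1E m2E.
by split; field; rewrite ?nz_m3 ?nz_m4.
Qed.

(** The functional kills the monic polynomial of degree [n] vanishing at all nodes, padded by a
    power of ['X] if there are fewer than [n]; only its leading term can contribute. *)
Lemma psum_vanish n (t : seq (K * K)) :
    (size t <= n)%N -> (forall i, (i < n)%N -> psum t i = 0) -> psum t n = 0.
Proof.
move=> le_tn t0; pose p := \prod_(w <- t) ('X - w.2%:P) * 'X^(n - size t).
have mon_p : p \is monic by rewrite monicMr ?monic_prod_XsubC ?monicXn.
have sz_p : size p = n.+1.
  rewrite /p size_Mmonic ?monicXn ?monic_neq0 ?monic_prod_XsubC //.
  by rewrite -(big_map snd xpredT (fun z => 'X - z%:P)) size_prod_XsubC size_polyXn size_map addnS addSn /= subnKC.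
have mfunE (q : {poly K}) : mfun (psum t) q = \sum_(w <- t) w.1 * q.[w.2].
  rewrite /mfun /psum; under eq_bigr do rewrite mulr_sumr.
  rewrite exchange_big /=; apply: eq_bigr => w _.
  by rewrite horner_coef mulr_sumr; apply: eq_bigr => i _; rewrite mulrCA.
have : mfun (psum t) p = 0.
  rewrite mfunE big_seq big1 // => w t_w; rewrite hornerM horner_prod.
  rewrite (big_rem w) //= hornerXsubC subrr !mul0r mulr0 //.
rewrite /mfun sz_p big_ord_recr /= big1 ?add0r => [|i _]; last by rewrite t0 ?mulr0.
have -> : p`_n = 1 by have := monicP mon_p; rewrite lead_coefE sz_p.
by rewrite mul1r.
Qed.

End BinaryQuartics.

(** * Ternary quartics as weighted point sets *)

Section Quartics.
Variable K : closedFieldType.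

(** Used both for points and for linear forms, paired by [dot]. *)
Definition vec : Type := K * K * K.
Definition dot (a p : vec) : K := a.1.1 * p.1.1 + a.1.2 * p.1.2 + a.2 * p.2.
Definition lc x (u : vec) y (v : vec) z (w : vec) : vec :=
  (x * u.1.1 + y * v.1.1 + z * w.1.1, x * u.1.2 + y * v.1.2 + z * w.1.2,
   x * u.2 + y * v.2 + z * w.2).
Definition cross (u v : vec) : vec :=
  (u.1.2 * v.2 - u.2 * v.1.2, u.2 * v.1.1 - u.1.1 * v.2,
   u.1.1 * v.1.2 - u.1.2 * v.1.1).
Definition det3 (u v w : vec) : K := dot u (cross v w).

Lemma dot_lcl x u y v z w p :
  dot (lc x u y v z w) p = x * dot u p + y * dot v p + z * dot w p.
Proof. by rewrite /dot /lc /=; ring. Qed.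

Lemma dot_lcr x u y v z w p :
  dot p (lc x u y v z w) = x * dot p u + y * dot p v + z * dot p w.
Proof. by rewrite /dot /lc /=; ring. Qed.

(** The cross products, divided by the determinant, form the dual basis of [u], [v], [w]. *)
Lemma dual_decomposition u v w L p : det3 u v w != 0 ->
  dot L p = (dot u p * dot L (cross v w) + dot v p * dot L (cross w u)
             + dot w p * dot L (cross u v)) / det3 u v w.
Proof.
move=> nz; apply: (mulIf nz); rewrite divfK //.
by rewrite /det3 /dot /cross /=; ring.
Qed.

(* A weighted point set [s] represents the quartic sum of w (p . x)^4 over
   its elements (w, p); [integ s G] is the contraction of that quartic, up to
   the factor 4!, with a quartic G in the dual variables. *)
Definition integ (s : seq (K * vec)) (G : vec -> K) : K :=
  \sum_(w <- s) w.1 * G w.2.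

(** Arbitrary weights are harmless, since every scalar has a fourth root. Two quartics are compared
    through their values at all [L]. *)
Definition vrank_le r (s : seq (K * vec)) : Prop :=
  exists2 t, (size t <= r)%N &
    forall L, integ s (fun p => dot L p ^+ 4) = integ t (fun p => dot L p ^+ 4).

Definition mom (s : seq (K * vec)) (f g h : vec -> K) i j k : K :=
  integ s (fun p => f p ^+ i * g p ^+ j * h p ^+ k).

Definition apolar (s : seq (K * vec)) (q : vec -> K) : Prop :=
  forall a b, integ s (fun p => q p * (dot a p * dot b p)) = 0.

Lemma eq_integ s F G : F =1 G -> integ s F = integ s G.
Proof. by move=> eqFG; apply: eq_bigr => w _; rewrite eqFG. Qed.

Lemma integD s F G : integ s (fun p => F p + G p) = integ s F + integ s G.
Proof. by rewrite /integ -big_split; apply: eq_bigr => w _; rewrite mulrDr. Qed.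

Lemma integZ s a F : integ s (fun p => a * F p) = a * integ s F.
Proof. by rewrite /integ mulr_sumr; apply: eq_bigr => w _; rewrite mulrCA. Qed.

Lemma integ_cat s1 s2 F : integ (s1 ++ s2) F = integ s1 F + integ s2 F.
Proof. exact: big_cat. Qed.

Lemma integ_cons x s F : integ (x :: s) F = x.1 * F x.2 + integ s F.
Proof. exact: big_cons. Qed.

Lemma vrank_le_widen r r' s : (r <= r')%N -> vrank_le r s -> vrank_le r' s.
Proof. by move=> le_rr' [t sz tE]; exists t; first exact: leq_trans le_rr'. Qed.

(** The extra point is cancelled by the same point with opposite weight. *)
Lemma vrank_le_cons r x s : vrank_le r (x :: s) -> vrank_le r.+1 s.
Proof.
case=> t sz tE; exists ((- x.1, x.2) :: t) => // L; rewrite integ_cons -tE.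
by rewrite integ_cons /=; ring.
Qed.

Lemma expand_quartic s (f g h : vec -> K) x y z :
  integ s (fun p => (x * f p + y * g p + z * h p) ^+ 4) =
    x ^+ 4 * mom s f g h 4 0 0 + 4%:R * x ^+ 3 * y * mom s f g h 3 1 0
  + 4%:R * x ^+ 3 * z * mom s f g h 3 0 1
  + 6%:R * x ^+ 2 * y ^+ 2 * mom s f g h 2 2 0
  + 12%:R * x ^+ 2 * y * z * mom s f g h 2 1 1
  + 6%:R * x ^+ 2 * z ^+ 2 * mom s f g h 2 0 2
  + 4%:R * x * y ^+ 3 * mom s f g h 1 3 0
  + 12%:R * x * y ^+ 2 * z * mom s f g h 1 2 1
  + 12%:R * x * y * z ^+ 2 * mom s f g h 1 1 2
  + 4%:R * x * z ^+ 3 * mom s f g h 1 0 3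
  + y ^+ 4 * mom s f g h 0 4 0 + 4%:R * y ^+ 3 * z * mom s f g h 0 3 1
  + 6%:R * y ^+ 2 * z ^+ 2 * mom s f g h 0 2 2
  + 4%:R * y * z ^+ 3 * mom s f g h 0 1 3 + z ^+ 4 * mom s f g h 0 0 4.
Proof.
rewrite /mom; elim: s => [|w s IH]; first by rewrite /integ !big_nil; ring.
by rewrite !integ_cons IH; ring.
Qed.

Lemma monomials4 (P : nat -> nat -> nat -> Prop) :
    P 4 0 0 -> P 3 1 0 -> P 3 0 1 -> P 2 2 0 -> P 2 1 1 -> P 2 0 2 ->
    P 1 3 0 -> P 1 2 1 -> P 1 1 2 -> P 1 0 3 -> P 0 4 0 -> P 0 3 1 ->
    P 0 2 2 -> P 0 1 3 -> P 0 0 4 ->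
  forall i j k, (i + j + k = 4)%N -> P i j k.
Proof.
do 15 move=> ?.
by case=> [|[|[|[|[|i]]]]] [|[|[|[|[|j]]]]] [|[|[|[|[|k]]]]] //;
  rewrite ?addnS ?addSn.
Qed.

(** By [expand_quartic] fifteen moments determine the quartic. The points of [t] are given in the
    coordinates [u], [v], [w], and [A] carries them back through the dual basis. *)
Lemma vrank_le_coords s u v w t : det3 u v w != 0 ->
    (forall i j k, (i + j + k = 4)%N -> mom s (dot u) (dot v) (dot w) i j k =
      mom t (fun p => p.1.1) (fun p => p.1.2) (fun p => p.2) i j k) ->
  vrank_le (size t) s.
Proof.
move=> nz tE; pose d := det3 u v w.
pose A (p : vec) : vec := lc (p.1.1 / d) (cross v w) (p.1.2 / d) (cross w u)
  (p.2 / d) (cross u v).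
exists [seq (x.1, A x.2) | x <- t]; first by rewrite size_map.
move=> L; transitivity (integ s (fun p => (dot L (cross v w) / d * dot u p +
  dot L (cross w u) / d * dot v p + dot L (cross u v) / d * dot w p) ^+ 4)).
  apply: eq_integ => p; congr (_ ^+ _).
  by rewrite (dual_decomposition L p nz) -/d; field.
transitivity (integ t (fun p => (dot L (cross v w) / d * p.1.1 +
  dot L (cross w u) / d * p.1.2 + dot L (cross u v) / d * p.2) ^+ 4)).
  by rewrite !expand_quartic !tE.
rewrite /integ big_map; apply: eq_bigr => x _; congr (_ * _ ^+ _).
by rewrite dot_lcr; ring.
Qed.

End Quartics.

(** * Apolar pairs of lines and smooth conics *)

Section ApolarConics.
Variable K : closedFieldType.
Hypothesis charK0 : [pchar K] =i pred0.
Local Notation vec := (vec K).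
Implicit Types (s : seq (K * vec)) (u v w a b : vec).

Lemma natK_neq0 n : n.+1%:R != 0 :> K.
Proof. by move/pcharf0P: charK0 => ->. Qed.

Lemma sqrt_exists (x : K) : exists r, r ^+ 2 = x.
Proof.
have [r rE] := @GRing.solve_monicpoly K 2 (fun i => if i == 0%N then x else 0) isT.
by exists r; rewrite rE !big_ord_recl big_ord0 /= expr0; ring.
Qed.

Lemma avoid2 (a b : K) : exists2 x, x != a & x != b.
Proof.
have /closed_nonrootP[x] : ('X - a%:P) * ('X - b%:P) != 0.
  by rewrite mulf_neq0 // polyXsubC_eq0.
by rewrite rootM !root_XsubC negb_or => /andP[]; exists x.
Qed.

Lemma expand_apolar s (q f g h : vec -> K) x y z x' y' z' :
  integ s (fun p => q p * ((x * f p + y * g p + z * h p) *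
                           (x' * f p + y' * g p + z' * h p))) =
    x * x' * integ s (fun p => q p * (f p * f p))
  + (x * y' + y * x') * integ s (fun p => q p * (f p * g p))
  + (x * z' + z * x') * integ s (fun p => q p * (f p * h p))
  + y * y' * integ s (fun p => q p * (g p * g p))
  + (y * z' + z * y') * integ s (fun p => q p * (g p * h p))
  + z * z' * integ s (fun p => q p * (h p * h p)).
Proof.
elim: s => [|c s IH]; first by rewrite /integ !big_nil; ring.
by rewrite !integ_cons IH; ring.
Qed.

Lemma apolar_basis s q u v w : det3 u v w != 0 ->
    integ s (fun p => q p * (dot u p * dot u p)) = 0 ->
    integ s (fun p => q p * (dot u p * dot v p)) = 0 ->
    integ s (fun p => q p * (dot u p * dot w p)) = 0 ->
    integ s (fun p => q p * (dot v p * dot v p)) = 0 ->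
    integ s (fun p => q p * (dot v p * dot w p)) = 0 ->
    integ s (fun p => q p * (dot w p * dot w p)) = 0 ->
  apolar s q.
Proof.
move=> nz uu uv uw vv vw ww a b.
pose c (L : vec) (M : vec) := dot L M / det3 u v w.
transitivity (integ s (fun p => q p * (
   (c a (cross v w) * dot u p + c a (cross w u) * dot v p + c a (cross u v) * dot w p) *
   (c b (cross v w) * dot u p + c b (cross w u) * dot v p + c b (cross u v) * dot w p)))).
  apply: eq_integ => p; rewrite (dual_decomposition a p nz) (dual_decomposition b p nz).
  by rewrite /c; field.
by rewrite expand_apolar uu uv uw vv vw ww !mulr0 !addr0.
Qed.

Lemma eq_apolar s q q' : q =1 q' -> apolar s q -> apolar s q'.
Proof.
by move=> eq_q apo a b; rewrite -(apo a b); apply: eq_integ => p; rewrite eq_q.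
Qed.

Lemma apolar_lin s q q' x y : apolar s q -> apolar s q' ->
  apolar s (fun p => x * q p + y * q' p).
Proof.
move=> apo apo' a b.
transitivity (x * integ s (fun p => q p * (dot a p * dot b p)) +
              y * integ s (fun p => q' p * (dot a p * dot b p))).
  by rewrite -!integZ -integD; apply: eq_integ => p; ring.
by rewrite apo apo' !mulr0 addr0.
Qed.

(** * Apolarity in coordinates [u], [v], [w] *)

Section Coordinates.
Variables (s : seq (K * vec)) (u v w : vec).
Hypothesis nz_uvw : det3 u v w != 0.
Definition momd (i j k : nat) := mom s (dot u) (dot v) (dot w) i j k.
Local Notation "'M[' i , j , k ]" := (momd i%N j%N k%N) (format "'M[' i , j , k ]").

(** This leaves a sum of two binary quartics with only the third variable in common. *)
Lemma product_moments : apolar s (fun p => dot u p * dot v p) ->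
  [/\ M[3, 1, 0] = 0, M[2, 2, 0] = 0 & M[2, 1, 1] = 0] /\
  [/\ M[1, 3, 0] = 0, M[1, 2, 1] = 0 & M[1, 1, 2] = 0].
Proof.
move=> apo.
have mixed a b i j k : (forall p, dot u p ^+ i * dot v p ^+ j * dot w p ^+ k =
    dot u p * dot v p * (dot a p * dot b p)) -> M[i, j, k] = 0.
  by move=> E; rewrite -(apo a b); apply: eq_integ.
split; split.
- by apply: (mixed u u) => p; ring.
- by apply: (mixed u v) => p; ring.
- by apply: (mixed u w) => p; ring.
- by apply: (mixed v v) => p; ring.
- by apply: (mixed v w) => p; ring.
by apply: (mixed w w) => p; ring.
Qed.

(** The coefficient of the common fourth power may be shared between the two binary quartics in any
    way. *)
Lemma vrank_two_lines r1 r2 x y : apolar s (fun p => dot u p * dot v p) ->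
    x + y = M[0, 0, 4] ->
    brank_le r1 x M[1, 0, 3] M[2, 0, 2] M[3, 0, 1] M[4, 0, 0] ->
    brank_le r2 y M[0, 1, 3] M[0, 2, 2] M[0, 3, 1] M[0, 4, 0] ->
  vrank_le (r1 + r2) s.
Proof.
move=> apo xy [t1 sz1 [a0 a1 a2 a3 a4]] [t2 sz2 [b0 b1 b2 b3 b4]].
pose t := [seq (c.1, (c.2.1, 0, c.2.2)) | c <- t1] ++
          [seq (c.1, (0, c.2.1, c.2.2)) | c <- t2].
have le_t : (size t <= r1 + r2)%N by rewrite size_cat !size_map leq_add.
apply: (vrank_le_widen le_t); apply: (vrank_le_coords nz_uvw).
have tE i j k : mom t (fun p => p.1.1) (fun p => p.1.2) (fun p => p.2) i j k =
    0 ^+ j * bsum t1 i k + 0 ^+ i * bsum t2 j k.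
  rewrite /mom integ_cat /integ !big_map !mulr_sumr.
  by congr (_ + _); apply: eq_bigr => c _ /=; ring.
have [[M310 M220 M211] [M130 M121 M112]] := product_moments apo.
by apply: monomials4; rewrite tE -/(momd _ _ _)
  ?(M310, M220, M211, M130, M121, M112, a0, a1, a2, a3, a4, b0, b1, b2, b3, b4);
  rewrite ?expr0 ?expr0n /= ?(mul0r, mul1r, add0r, addr0).
Qed.

Lemma vrank_two_lines6 : apolar s (fun p => dot u p * dot v p) ->
    ~ [/\ M[2, 0, 2] = 0, M[3, 0, 1] = 0 & M[4, 0, 0] = 0] ->
    ~ [/\ M[0, 2, 2] = 0, M[0, 3, 1] = 0 & M[0, 4, 0] = 0] ->
  vrank_le 6 s.
Proof.
move=> apo /(brank3_generic charK0 M[1, 0, 3])[a gena].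
move=> /(brank3_generic charK0 M[0, 1, 3])[b genb].
(* Each binary quartic has one bad value: [x] must avoid [a], and the remaining share must avoid
   [b]. *)
have [x neq_a neq_b] := avoid2 a (M[0, 0, 4] - b).
apply: (@vrank_two_lines 3 3 x (M[0, 0, 4] - x) apo); first by rewrite addrC subrK.
  exact: gena.
by apply: genb; apply: contraNneq neq_b => <-; rewrite opprB addrC subrK.
Qed.

(* The derivative at 0 of a polynomial [p] of degree at most 4 is
   (8 p(1) - 8 p(-1) - p(2) + p(-2)) / 12. *)
Definition diff_weights : seq (K * K) :=
  [:: (2%:R / 3%:R, 1); (- (2%:R / 3%:R), - 1);
      (- (1 / 12%:R), 2%:R); (1 / 12%:R, - 2%:R)].

(** z^3 times a linear form is the derivative at c = 0 of (z + c l)^4 for a suitable l, and the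
    difference formula expresses it by four fourth powers. *)
Lemma brank_cube_mul_linear (x y : K) : brank_le 4 x y 0 0 0.
Proof.
exists [seq (c.1, (c.2 * y, 1 + c.2 * (x / 4%:R))) | c <- diff_weights] => //.
by rewrite /bsum !big_cons !big_nil /=; split; field;
   rewrite !natK_neq0.
Qed.

Lemma vrank_two_lines7 : apolar s (fun p => dot u p * dot v p) -> vrank_le 7 s.
Proof.
move=> apo.
have triv (a b c : K) : ~ [/\ a = 0, b = 0 & c = 0] \/ [/\ a = 0, b = 0 & c = 0].
  have [->|/eqP nz] := eqVneq a 0; last by left; case.
  have [->|/eqP nz] := eqVneq b 0; last by left; case.
  by have [->|/eqP nz] := eqVneq c 0; [right | left; case].
have [nza | [a2 a3 a4]] := triv M[2, 0, 2] M[3, 0, 1] M[4, 0, 0];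
have [nzb | [b2 b3 b4]] := triv M[0, 2, 2] M[0, 3, 1] M[0, 4, 0].
- by apply: (@vrank_le_widen _ 6) => //; apply: vrank_two_lines6.
- have [a gena] := brank3_generic charK0 M[1, 0, 3] nza.
  have [x neq_a _] := avoid2 a 0.
  apply: (@vrank_two_lines 3 4 x (M[0, 0, 4] - x) apo).
  + by rewrite addrC subrK.
  + exact: gena.
  by rewrite b2 b3 b4; apply: brank_cube_mul_linear.
- have [b genb] := brank3_generic charK0 M[0, 1, 3] nzb.
  have [x neq_b _] := avoid2 b 0.
  apply: (@vrank_two_lines 4 3 (M[0, 0, 4] - x) x apo).
  + by rewrite subrK.
  + by rewrite a2 a3 a4; apply: brank_cube_mul_linear.
  exact: genb.
(* Both binary quartics are z^3 times a linear form, hence so is their sum, and four points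
   suffice. *)
pose t : seq (K * vec) := [seq (c.1, (c.2 * M[1, 0, 3], c.2 * M[0, 1, 3],
  1 + c.2 * (M[0, 0, 4] / 4%:R))) | c <- diff_weights].
apply: (@vrank_le_widen _ (size t)) => //; apply: (vrank_le_coords nz_uvw).
have [[M310 M220 M211] [M130 M121 M112]] := product_moments apo.
by apply: monomials4; rewrite -/(momd _ _ _)
  ?(M310, M220, M211, M130, M121, M112, a2, a3, a4, b2, b3, b4) /mom /integ
  big_map /t /diff_weights !big_cons !big_nil /=; field; rewrite ?natK_neq0.
Qed.

(** On the conic, parametrized by (1, t, t^2), the monomial with exponents [i], [j], [k] becomes
    t^(j + 2k). The moments are thus those of a binary octic, and the second hypothesis makes its
    Hankel matrix invertible. *)
Lemma vrank_smooth : apolar s (fun p => dot u p * dot w p - dot v p ^+ 2) ->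
    (forall h0 h1 h2 h3 h4,
       apolar s (fun p => h0 * dot u p ^+ 2 + h1 * (dot u p * dot v p)
         + h2 * dot v p ^+ 2 + h3 * (dot v p * dot w p) + h4 * dot w p ^+ 2) ->
       [/\ h0 = 0, h1 = 0, h2 = 0, h3 = 0 & h4 = 0]) ->
  vrank_le 5 s.
Proof.
move=> apo ker0.
pose c := nth 0 [:: M[4, 0, 0]; M[3, 1, 0]; M[2, 2, 0]; M[1, 3, 0]; M[0, 4, 0];
                   M[0, 3, 1]; M[0, 2, 2]; M[0, 1, 3]; M[0, 0, 4]].
have same a b i j k i' j' k' : (forall p,
    dot u p ^+ i * dot v p ^+ j * dot w p ^+ k =
    (dot u p * dot w p - dot v p ^+ 2) * (dot a p * dot b p) +
     dot u p ^+ i' * dot v p ^+ j' * dot w p ^+ k') -> M[i, j, k] = M[i', j', k'].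
  move=> E; rewrite /momd /mom (eq_integ s E) integD apo add0r //.
have M301 : M[3, 0, 1] = M[2, 2, 0] by apply: (same u u) => p; ring.
have M211 : M[2, 1, 1] = M[1, 3, 0] by apply: (same u v) => p; ring.
have M202 : M[2, 0, 2] = M[1, 2, 1] by apply: (same u w) => p; ring.
have M121 : M[1, 2, 1] = M[0, 4, 0] by apply: (same v v) => p; ring.
have M112 : M[1, 1, 2] = M[0, 3, 1] by apply: (same v w) => p; ring.
have M103 : M[1, 0, 3] = M[0, 2, 2] by apply: (same w w) => p; ring.
have cE : forall i j k, (i + j + k = 4)%N -> M[i, j, k] = c (j + (k + k))%N.
  by apply: monomials4; rewrite ?M301 ?M211 ?M202 ?M121 ?M112 ?M103.
have [h sz_h hc | t sz_t ct] := @psum_of_hankel _ charK0 4 c.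
  (* A conic whose restriction to (1, t, t^2) is [h]. *)
  pose q p := h`_0 * dot u p ^+ 2 + h`_1 * (dot u p * dot v p)
         + h`_2 * dot v p ^+ 2 + h`_3 * (dot v p * dot w p) + h`_4 * dot w p ^+ 2.
  have hE j : (j <= 4)%N -> h`_0 * c j + h`_1 * c j.+1 + h`_2 * c j.+2 +
      h`_3 * c j.+3 + h`_4 * c j.+4 = 0.
    move=> /hc; rewrite mfunMXn (mfun_wide _ sz_h) !big_ord_recl big_ord0 /=.
    by rewrite addr0 !add0n !addrA.
  have qE a b i j k : (i + j + k = 2)%N ->
      (forall p, dot a p * dot b p = dot u p ^+ i * dot v p ^+ j * dot w p ^+ k) ->
      integ s (fun p => q p * (dot a p * dot b p)) =
      h`_0 * M[i.+2, j, k] + h`_1 * M[i.+1, j.+1, k] + h`_2 * M[i, j.+2, k]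
      + h`_3 * M[i, j.+1, k.+1] + h`_4 * M[i, j, k.+2].
    move=> _ E; rewrite /momd /mom -!integZ -!integD; apply: eq_integ => p.
    rewrite E /q !exprS !expr0.
    move: (dot u p ^+ i) (dot v p ^+ j) (dot w p ^+ k) => U V W; ring.
  have zero a b i j k : (i + j + k = 2)%N ->
      (forall p, dot a p * dot b p = dot u p ^+ i * dot v p ^+ j * dot w p ^+ k) ->
      integ s (fun p => q p * (dot a p * dot b p)) = 0.
    move=> ijk E; rewrite (qE a b i j k) // !cE ?addSn ?addnS ?addSn ?ijk //.
    apply: etrans (hE (j + (k + k))%N _) => //.
    by case: i j k ijk {E} => [|[|[|i]]] [|[|[|j]]] [|[|[|k]]].
  have /ker0[h0 h1 h2 h3 h4] : apolar s q.
    apply: (apolar_basis nz_uvw).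
    - by apply: (zero _ _ 2 0 0) => // p; ring.
    - by apply: (zero _ _ 1 1 0) => // p; ring.
    - by apply: (zero _ _ 1 0 1) => // p; ring.
    - by apply: (zero _ _ 0 2 0) => // p; ring.
    - by apply: (zero _ _ 0 1 1) => // p; ring.
    - by apply: (zero _ _ 0 0 2) => // p; ring.
  apply/polyP => -[|[|[|[|[|i]]]]]; rewrite coef0 //.
  by rewrite nth_default // (leq_trans sz_h).
pose t' : seq (K * vec) := [seq (x.1, (1, x.2, x.2 ^+ 2)) | x <- t].
apply: (@vrank_le_widen _ (size t')); first by rewrite size_map.
apply: (vrank_le_coords nz_uvw) => i j k ijk; rewrite -/(momd i j k) cE //.
rewrite ct; last first.
  by case: i j k ijk => [|[|[|[|[|i]]]]] [|[|[|[|[|j]]]]] [|[|[|[|[|k]]]]].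
rewrite /mom /integ /psum big_map; apply: eq_bigr => x _ /=.
by rewrite expr1n mul1r -exprM mul2n -addnn -exprD.
Qed.

End Coordinates.

End ApolarConics.

(** * Apolar singular conics *)

Section SingularConics.
Variable K : closedFieldType.
Hypothesis charK0 : [pchar K] =i pred0.
Local Notation vec := (vec K).
Implicit Types (s : seq (K * vec)) (u v w a b : vec).

Lemma dual_point u v w x y z : det3 u v w != 0 ->
  exists p, [/\ dot u p = x, dot v p = y & dot w p = z].
Proof.
move=> nz; exists (lc (x / det3 u v w) (cross v w) (y / det3 u v w) (cross w u)
                      (z / det3 u v w) (cross u v)).
have rep0 a b : (dot a (cross b a) = 0) * (dot a (cross a b) = 0).
  by split; rewrite /dot /cross /=; ring.
have rot1 : dot v (cross w u) = det3 u v w by rewrite /det3 /dot /cross /=; ring.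
have rot2 : dot w (cross u v) = det3 u v w by rewrite /det3 /dot /cross /=; ring.
rewrite !dot_lcr !rep0 rot1 rot2 -/(det3 u v w) !divfK // !mulr0 !addr0 add0r.
by split=> //; rewrite add0r.
Qed.

Section Normalized.
Variables (s : seq (K * vec)) (u v w : vec).
Hypothesis nz_uvw : det3 u v w != 0.
Local Notation "'M[' i , j , k ]" := (momd s u v w i%N j%N k%N).

(** The quartic is then z times a binary cubic plus a binary quartic, both in the first two
    variables. *)
Lemma square_moments : apolar s (fun p => dot w p ^+ 2) ->
  [/\ M[2, 0, 2] = 0, M[1, 1, 2] = 0 & M[0, 2, 2] = 0] /\
  [/\ M[1, 0, 3] = 0, M[0, 1, 3] = 0 & M[0, 0, 4] = 0].
Proof.
move=> apo.
have mixed a b i j k : (forall p, dot u p ^+ i * dot v p ^+ j * dot w p ^+ k =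
    dot w p ^+ 2 * (dot a p * dot b p)) -> M[i, j, k] = 0.
  by move=> E; rewrite -(apo a b); apply: eq_integ.
split; split.
- by apply: (mixed u u) => p; ring.
- by apply: (mixed u v) => p; ring.
- by apply: (mixed v v) => p; ring.
- by apply: (mixed u w) => p; ring.
- by apply: (mixed v w) => p; ring.
by apply: (mixed w w) => p; ring.
Qed.

(** The equations put the coefficient vector of [q] in the kernel of the catalecticant written in
    the coordinates [u], [v], [w]. *)
Lemma apolar_moments (q : vec -> K) c1 c2 c3 c4 c5 c6 :
    (forall p, q p = c1 * dot u p ^+ 2 + c2 * (dot u p * dot v p)
       + c3 * (dot u p * dot w p) + c4 * dot v p ^+ 2
       + c5 * (dot v p * dot w p) + c6 * dot w p ^+ 2) ->
    c1 * M[4, 0, 0] + c2 * M[3, 1, 0] + c3 * M[3, 0, 1] + c4 * M[2, 2, 0]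
      + c5 * M[2, 1, 1] + c6 * M[2, 0, 2] = 0 ->
    c1 * M[3, 1, 0] + c2 * M[2, 2, 0] + c3 * M[2, 1, 1] + c4 * M[1, 3, 0]
      + c5 * M[1, 2, 1] + c6 * M[1, 1, 2] = 0 ->
    c1 * M[3, 0, 1] + c2 * M[2, 1, 1] + c3 * M[2, 0, 2] + c4 * M[1, 2, 1]
      + c5 * M[1, 1, 2] + c6 * M[1, 0, 3] = 0 ->
    c1 * M[2, 2, 0] + c2 * M[1, 3, 0] + c3 * M[1, 2, 1] + c4 * M[0, 4, 0]
      + c5 * M[0, 3, 1] + c6 * M[0, 2, 2] = 0 ->
    c1 * M[2, 1, 1] + c2 * M[1, 2, 1] + c3 * M[1, 1, 2] + c4 * M[0, 3, 1]
      + c5 * M[0, 2, 2] + c6 * M[0, 1, 3] = 0 ->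
    c1 * M[2, 0, 2] + c2 * M[1, 1, 2] + c3 * M[1, 0, 3] + c4 * M[0, 2, 2]
      + c5 * M[0, 1, 3] + c6 * M[0, 0, 4] = 0 ->
  apolar s q.
Proof.
move=> qE uu uv uw vv vw ww; apply: (apolar_basis nz_uvw).
- by rewrite -uu /momd /mom -!integZ -!integD; apply: eq_integ => p; rewrite qE; ring.
- by rewrite -uv /momd /mom -!integZ -!integD; apply: eq_integ => p; rewrite qE; ring.
- by rewrite -uw /momd /mom -!integZ -!integD; apply: eq_integ => p; rewrite qE; ring.
- by rewrite -vv /momd /mom -!integZ -!integD; apply: eq_integ => p; rewrite qE; ring.
- by rewrite -vw /momd /mom -!integZ -!integD; apply: eq_integ => p; rewrite qE; ring.
by rewrite -ww /momd /mom -!integZ -!integD; apply: eq_integ => p; rewrite qE; ring.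
Qed.

End Normalized.

Lemma momd_cons x s u v w i j k : momd (x :: s) u v w i j k =
  x.1 * (dot u x.2 ^+ i * dot v x.2 ^+ j * dot w x.2 ^+ k) + momd s u v w i j k.
Proof. exact: integ_cons. Qed.

Lemma det3_rot u v w : det3 v w u = det3 u v w.
Proof. by rewrite /det3 /dot /cross /=; ring. Qed.

Lemma det3_swap u v w : det3 u w v = - det3 u v w.
Proof. by rewrite /det3 /dot /cross /=; ring. Qed.

(* The quartic w (x^3 + y^3) + h(x, y): removing one power kills the middle
   coefficient of [h], after which a pair of lines is apolar. *)
Lemma vrank_double_line_xy s u v w : det3 u v w != 0 ->
    apolar s (fun p => dot w p ^+ 2) ->
    momd s u v w 2 1 1 = 0 -> momd s u v w 1 2 1 = 0 ->
  vrank_le 7 s.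
Proof.
move=> nz apo M211 M121.
have [[M202 M112 M022] [M103 M013 M004]] := square_moments u v apo.
have [a0 | nza] := eqVneq (momd s u v w 3 0 1) 0.
  apply: (@vrank_two_lines7 _ charK0 s u w v); first by rewrite det3_swap oppr_eq0.
  apply: (@apolar_moments s u v w nz _ 0 0 1 0 0 0); first (by move=> p; ring);
    by rewrite ?M211 ?M121 ?M202 ?M112 ?M022 ?M103 ?M013 ?M004 ?a0; ring.
have [b0 | nzb] := eqVneq (momd s u v w 0 3 1) 0.
  apply: (@vrank_two_lines7 _ charK0 s v w u); first by rewrite det3_rot.
  apply: (@apolar_moments s u v w nz _ 0 0 0 0 1 0); first (by move=> p; ring);
    by rewrite ?M211 ?M121 ?M202 ?M112 ?M022 ?M103 ?M013 ?M004 ?b0; ring.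
set a := momd s u v w 3 0 1 in nza; set b := momd s u v w 0 3 1 in nzb.
(* Removing a multiple of (x + y)^4 kills the moment of x^2 y^2. *)
have [p0 [u0 v0 w0]] := dual_point 1 1 0 nz.
pose t := momd s u v w 2 2 0.
pose s' := (- t, p0) :: s.
have M'E i j k : momd s' u v w i j k = momd s u v w i j k - t * 0 ^+ k.
  by rewrite momd_cons /= u0 v0 w0 !expr1n !mul1r; ring.
(* These shifts are forced by contracting the product of [U] and [V] with the squares of [u] and
   [v]. *)
pose be := (momd s u v w 3 1 0 - t) / a; pose al := (momd s u v w 1 3 0 - t) / b.
pose U := lc 1 u 0 v (- al) w; pose V := lc 0 u 1 v (- be) w.
have nzUV : det3 U V w != 0.
  suff -> : det3 U V w = det3 u v w by [].
  by rewrite /det3 /dot /cross /=; ring.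
have apo' : apolar s' (fun p => dot U p * dot V p).
  apply: (@apolar_moments s' u v w nz _ 0 1 (- be) 0 (- al) (al * be));
  first (by move=> p; rewrite !dot_lcl; ring);
  rewrite !M'E ?M211 ?M121 ?M202 ?M112 ?M022 ?M103 ?M013 ?M004;
  rewrite ?expr0 ?expr0n /= -?/a -?/b -?/t /be /al;
  by field; rewrite ?nza ?nzb.
have [[M'202 M'112 M'022] [M'103 M'013 M'004]] :
  [/\ momd s' u v w 2 0 2 = 0, momd s' u v w 1 1 2 = 0 & momd s' u v w 0 2 2 = 0] /\
  [/\ momd s' u v w 1 0 3 = 0, momd s' u v w 0 1 3 = 0 & momd s' u v w 0 0 4 = 0].
  by rewrite !M'E M202 M112 M022 M103 M013 M004 !expr0n /= mulr0 subr0.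
have aE : momd s' U V w 3 0 1 = a.
  transitivity (momd s' u v w 3 0 1 + (- (3%:R * al)) * momd s' u v w 2 0 2
    + 3%:R * al ^+ 2 * momd s' u v w 1 0 3 + (- al ^+ 3) * momd s' u v w 0 0 4).
    rewrite /momd /mom -!integZ -!integD; apply: eq_integ => p.
    by rewrite !dot_lcl; ring.
  by rewrite M'202 M'103 M'004 M'E expr0n /= /a; ring.
have bE : momd s' U V w 0 3 1 = b.
  transitivity (momd s' u v w 0 3 1 + (- (3%:R * be)) * momd s' u v w 0 2 2
    + 3%:R * be ^+ 2 * momd s' u v w 0 1 3 + (- be ^+ 3) * momd s' u v w 0 0 4).
    rewrite /momd /mom -!integZ -!integD; apply: eq_integ => p.
    by rewrite !dot_lcl; ring.
  by rewrite M'022 M'013 M'004 M'E expr0n /= /b; ring.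
apply: (@vrank_le_cons _ 6 (- t, p0)); apply: (vrank_two_lines6 charK0 nzUV apo').
  by rewrite aE => -[_ /eqP]; rewrite (negbTE nza).
by rewrite bE => -[_ /eqP]; rewrite (negbTE nzb).
Qed.

(* The quartic a x y^2 w + e x^3 y + d y^4, up to binomial factors. *)
Lemma vrank_tangent s u v w : det3 u v w != 0 ->
    apolar s (fun p => dot w p ^+ 2) ->
    momd s u v w 4 0 0 = 0 -> momd s u v w 2 2 0 = 0 -> momd s u v w 1 3 0 = 0 ->
    momd s u v w 3 0 1 = 0 -> momd s u v w 2 1 1 = 0 -> momd s u v w 0 3 1 = 0 ->
    momd s u v w 1 2 1 != 0 ->
  vrank_le 6 s.
Proof.
move=> nz apo M400 M220 M130 M301 M211 M031 nza.
have [[M202 M112 M022] [M103 M013 M004]] := square_moments u v apo.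
set a := momd s u v w 1 2 1 in nza.
pose e := momd s u v w 3 1 0; have [e0 | nze] := eqVneq e 0.
  (* For [e = 0] the conic u^2 - w^2 is apolar, a product of two distinct lines. *)
  pose U := lc 1 u 0 v (- 1) w; pose W := lc 1 u 0 v 1 w.
  have nzUW : det3 U W v != 0.
    suff -> : det3 U W v = - (2%:R * det3 u v w).
      by rewrite oppr_eq0 mulf_neq0 ?(natK_neq0 charK0).
    by rewrite /det3 /dot /cross /=; ring.
  have apo' : apolar s (fun p => dot U p * dot W p).
    apply: (@apolar_moments s u v w nz _ 1 0 0 0 0 (- 1));
    first (by move=> p; rewrite !dot_lcl; ring);
    rewrite ?M400 -/e ?e0 ?M220 ?M130 ?M301 ?M211 ?M031 ?M202 ?M112 ?M022 ?M103 ?M013 ?M004;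
    by ring.
  have nz2a : 2%:R * a != 0 by rewrite mulf_neq0 ?(natK_neq0 charK0).
  apply: (vrank_two_lines6 charK0 nzUW apo').
    suff -> : momd s U W v 2 0 2 = - (2%:R * a).
      by case=> /eqP; rewrite oppr_eq0 (negbTE nz2a).
    transitivity (momd s u v w 2 2 0 + (- 2%:R) * momd s u v w 1 2 1 + momd s u v w 0 2 2).
      by rewrite /momd /mom -!integZ -!integD; apply: eq_integ => p; rewrite !dot_lcl; ring.
    by rewrite M220 M022 /a; ring.
  suff -> : momd s U W v 0 2 2 = 2%:R * a.
    by case=> /eqP; rewrite (negbTE nz2a).
  transitivity (momd s u v w 2 2 0 + 2%:R * momd s u v w 1 2 1 + momd s u v w 0 2 2).
    by rewrite /momd /mom -!integZ -!integD; apply: eq_integ => p; rewrite !dot_lcl; ring.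
  by rewrite M220 M022 /a; ring.
(* Adding a fourth power at [p0] removes w^2 from the apolar conics and leaves v W - u^2; [W] is
   scaled so that this conic contracts to 0 with u v. *)
have [p0 [u0 v0 w0]] := dual_point 0 0 (a / e) nz.
pose W := lc 0 u 0 v (e / a) w.
have nzW : det3 v u W != 0.
  suff -> : det3 v u W = - (e / a * det3 u v w).
    by rewrite oppr_eq0 !mulf_neq0 ?invr_eq0.
  by rewrite /det3 /dot /cross /=; ring.
have W0 : dot W p0 = 1 by rewrite dot_lcl w0; field; rewrite nza nze.
apply: (@vrank_le_cons _ 5 (1, p0)); set s' := _ :: s.
have M'E i j k : momd s' v u W i j k =
    0 ^+ i * 0 ^+ j + (e / a) ^+ k * momd s u v w j i k.
  rewrite momd_cons /= u0 v0 W0 expr1n mul1r mulr1; congr (_ + _).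
  rewrite /momd /mom -integZ; apply: eq_integ => p; rewrite dot_lcl.
  have -> : 0 * dot u p + 0 * dot v p + e / a * dot w p = e / a * dot w p by ring.
  by rewrite exprMn; ring.
have zeros := (M400, M220, M130, M301, M211, M031, M202, M112, M022, M103, M013, M004).
have ae : e / a * a = e by rewrite divfK.
have apo' : apolar s' (fun p => dot v p * dot W p - dot u p ^+ 2).
  apply: (@apolar_moments s' v u W nzW _ 0 0 1 (- 1) 0 0);
    first (by move=> p; ring);
  rewrite !M'E ?expr0 ?expr0n /= ?zeros -?/a -?/e ?expr1;
  by rewrite ?ae; ring.
apply: (vrank_smooth charK0 nzW apo') => h0 h1 h2 h3 h4 apoh.
have test b c i j k : (forall p, dot b p * dot c p = dot v p ^+ i * dot u p ^+ j * dot W p ^+ k) ->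
    h0 * momd s' v u W i.+2 j k + h1 * momd s' v u W i.+1 j.+1 k
    + h2 * momd s' v u W i j.+2 k + h3 * momd s' v u W i j.+1 k.+1
    + h4 * momd s' v u W i j k.+2 = 0.
  move=> E; rewrite -[RHS](apoh b c) /momd /mom -!integZ -!integD.
  apply: eq_integ => p; rewrite E !exprS !expr0.
  by move: (dot u p ^+ j) (dot v p ^+ i) (dot W p ^+ k) => *; ring.
have simp := (M'E, expr0, expr0n).
(* The five contractions form a triangular system with diagonal entries [e], except 1 for [h4]. *)
have := test v v 2%N 0%N 0%N (fun p => ltac:(ring)).
have := test v u 1%N 1%N 0%N (fun p => ltac:(ring)).
have := test v W 1%N 0%N 1%N (fun p => ltac:(ring)).
have := test u W 0%N 1%N 1%N (fun p => ltac:(ring)).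
have := test W W 0%N 0%N 2%N (fun p => ltac:(ring)).
rewrite !simp /= ?zeros -?/a -?/e ?expr1 ?(mulr0, mul0r, addr0, add0r, mulr1, mul1r).
rewrite !ae => h40 /eqP; rewrite mulf_eq0 (negbTE nze) orbF => /eqP h00.
move=> /eqP; rewrite mulf_eq0 (negbTE nze) orbF => /eqP h10.
move=> /eqP; rewrite mulf_eq0 (negbTE nze) orbF => /eqP h20.
move=> /eqP; rewrite h00 mul0r add0r mulf_eq0 (negbTE nze) orbF => /eqP h30.
by split.
Qed.

(** A fourth power at [p0] clears the moment of x^4, and shifting [u] and [v] by multiples of [w]
    clears those of x^2 y^2 and x y^3. Moments linear in [w] are unaffected, so [vrank_tangent]
    applies. *)
Lemma vrank_double_line_xx_shifted s u v w : det3 u v w != 0 ->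
    apolar s (fun p => dot w p ^+ 2) ->
    momd s u v w 3 0 1 = 0 -> momd s u v w 2 1 1 = 0 -> momd s u v w 0 3 1 = 0 ->
    momd s u v w 1 2 1 != 0 ->
  vrank_le 7 s.
Proof.
move=> nz apo M301 M211 M031 nza.
have [[M202 M112 M022] [M103 M013 M004]] := square_moments u v apo.
set a := momd s u v w 1 2 1 in nza.
have [p0 [u0 v0 w0]] := dual_point 1 0 0 nz.
pose s' := (- momd s u v w 4 0 0, p0) :: s.
have M'E i j k : momd s' u v w i j k =
    momd s u v w i j k - momd s u v w 4 0 0 * (0 ^+ j * 0 ^+ k).
  by rewrite momd_cons /= u0 v0 w0 !expr1n !mul1r; ring.
have nat_neq0 := natK_neq0 charK0.
pose al := momd s u v w 2 2 0 / (2%:R * a).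
pose be := momd s u v w 1 3 0 / (3%:R * a).
pose U := lc 1 u 0 v (- al) w; pose V := lc 0 u 1 v (- be) w.
have nzUV : det3 U V w != 0.
  suff -> : det3 U V w = det3 u v w by [].
  by rewrite /det3 /dot /cross /=; ring.
have zeros := (M301, M211, M031, M202, M112, M022, M103, M013, M004).
apply: (@vrank_le_cons _ 6 (- momd s u v w 4 0 0, p0)).
have apo' : apolar s' (fun p => dot w p ^+ 2).
  move=> b c; rewrite integ_cons /= w0 expr0n /= mul0r mulr0 add0r; exact: apo.
have NE i j k : momd s' U V w i j k = integ s' (fun p =>
    (dot u p - al * dot w p) ^+ i * (dot v p - be * dot w p) ^+ j * dot w p ^+ k).
  rewrite /momd /mom; apply: eq_integ => p; rewrite !dot_lcl.
  by congr (_ ^+ _ * _ ^+ _ * _); ring.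
apply: (vrank_tangent nzUV apo'); rewrite ?NE.
- transitivity (momd s' u v w 4 0 0 + (- 4%:R * al) * momd s' u v w 3 0 1
    + (6%:R * al ^+ 2) * momd s' u v w 2 0 2
    + (- 4%:R * al ^+ 3) * momd s' u v w 1 0 3 + al ^+ 4 * momd s' u v w 0 0 4).
    by rewrite /momd /mom -!integZ -!integD; apply: eq_integ => p; ring.
  by rewrite !M'E !zeros ?expr0 ?expr0n /=; ring.
- transitivity (momd s' u v w 2 2 0 + (- 2%:R * al) * momd s' u v w 1 2 1
    + (- 2%:R * be) * momd s' u v w 2 1 1 + al ^+ 2 * momd s' u v w 0 2 2
    + 4%:R * al * be * momd s' u v w 1 1 2 + be ^+ 2 * momd s' u v w 2 0 2
    + (- 2%:R * al ^+ 2 * be) * momd s' u v w 0 1 3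
    + (- 2%:R * al * be ^+ 2) * momd s' u v w 1 0 3
    + al ^+ 2 * be ^+ 2 * momd s' u v w 0 0 4).
    by rewrite /momd /mom -!integZ -!integD; apply: eq_integ => p; ring.
  rewrite !M'E !zeros ?expr0 ?expr0n /= -/a /al.
  by field; rewrite ?nza ?nat_neq0.
- transitivity (momd s' u v w 1 3 0 + (- al) * momd s' u v w 0 3 1
    + (- 3%:R * be) * momd s' u v w 1 2 1
    + 3%:R * be ^+ 2 * momd s' u v w 1 1 2
    + 3%:R * al * be * momd s' u v w 0 2 2
    + (- be ^+ 3) * momd s' u v w 1 0 3
    + (- 3%:R * al * be ^+ 2) * momd s' u v w 0 1 3
    + al * be ^+ 3 * momd s' u v w 0 0 4).
    by rewrite /momd /mom -!integZ -!integD; apply: eq_integ => p; ring.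
  rewrite !M'E !zeros ?expr0 ?expr0n /= -/a /be.
  by field; rewrite ?nza ?nat_neq0.
- transitivity (momd s' u v w 3 0 1 + (- 3%:R * al) * momd s' u v w 2 0 2
    + 3%:R * al ^+ 2 * momd s' u v w 1 0 3 + (- al ^+ 3) * momd s' u v w 0 0 4).
    by rewrite /momd /mom -!integZ -!integD; apply: eq_integ => p; ring.
  by rewrite !M'E !zeros ?expr0 ?expr0n /=; ring.
- transitivity (momd s' u v w 2 1 1 + (- be) * momd s' u v w 2 0 2
    + (- 2%:R * al) * momd s' u v w 1 1 2 + (2%:R * al * be) * momd s' u v w 1 0 3
    + al ^+ 2 * momd s' u v w 0 1 3 + (- al ^+ 2 * be) * momd s' u v w 0 0 4).
    by rewrite /momd /mom -!integZ -!integD; apply: eq_integ => p; ring.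
  by rewrite !M'E !zeros ?expr0 ?expr0n /=; ring.
- transitivity (momd s' u v w 0 3 1 + (- 3%:R * be) * momd s' u v w 0 2 2
    + 3%:R * be ^+ 2 * momd s' u v w 0 1 3 + (- be ^+ 3) * momd s' u v w 0 0 4).
    by rewrite /momd /mom -!integZ -!integD; apply: eq_integ => p; ring.
  by rewrite !M'E !zeros ?expr0 ?expr0n /=; ring.
suff -> : integ s' (fun p => (dot u p - al * dot w p) ^+ 1 *
    (dot v p - be * dot w p) ^+ 2 * dot w p ^+ 1) = a by [].
transitivity (momd s' u v w 1 2 1 + (- 2%:R * be) * momd s' u v w 1 1 2
    + (- al) * momd s' u v w 0 2 2 + be ^+ 2 * momd s' u v w 1 0 3
    + (2%:R * al * be) * momd s' u v w 0 1 3 + (- al * be ^+ 2) * momd s' u v w 0 0 4).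
  by rewrite /momd /mom -!integZ -!integD; apply: eq_integ => p; ring.
by rewrite !M'E !zeros ?expr0 ?expr0n /= -/a; ring.
Qed.

(** The cubic factor is a combination of x y^2 and y^3. Without x y^2 the product of [u] and [w] is
    apolar; otherwise replacing [v] by [V] removes y^3. *)
Lemma vrank_double_line_xx s u v w : det3 u v w != 0 ->
    apolar s (fun p => dot w p ^+ 2) ->
    momd s u v w 3 0 1 = 0 -> momd s u v w 2 1 1 = 0 ->
  vrank_le 7 s.
Proof.
move=> nz apo M301 M211.
have [[M202 M112 M022] [M103 M013 M004]] := square_moments u v apo.
have [a0 | nza] := eqVneq (momd s u v w 1 2 1) 0.
  apply: (@vrank_two_lines7 _ charK0 s u w v); first by rewrite det3_swap oppr_eq0.
  apply: (@apolar_moments s u v w nz _ 0 0 1 0 0 0); first (by move=> p; ring);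
    by rewrite ?M211 ?M301 ?M202 ?M112 ?M022 ?M103 ?M013 ?M004 ?a0; ring.
have nat_neq0 := natK_neq0 charK0.
set a := momd s u v w 1 2 1 in nza; set b := momd s u v w 0 3 1.
pose c := b / (3%:R * a); pose V := lc (- c) u 1 v 0 w.
have nzV : det3 u V w != 0.
  suff -> : det3 u V w = det3 u v w by [].
  by rewrite /det3 /dot /cross /=; ring.
apply: (vrank_double_line_xx_shifted nzV apo).
- exact: M301.
- transitivity (momd s u v w 2 1 1 + (- c) * momd s u v w 3 0 1).
    by rewrite /momd /mom -!integZ -!integD; apply: eq_integ => p; rewrite dot_lcl; ring.
  by rewrite M211 M301; ring.
- transitivity (momd s u v w 0 3 1 + (- 3%:R * c) * momd s u v w 1 2 1
     + (3%:R * c ^+ 2) * momd s u v w 2 1 1 + (- c ^+ 3) * momd s u v w 3 0 1).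
    by rewrite /momd /mom -!integZ -!integD; apply: eq_integ => p; rewrite dot_lcl; ring.
  by rewrite M211 M301 -/a -/b /c; field; rewrite ?nza ?nat_neq0.
suff -> : momd s u V w 1 2 1 = a by [].
transitivity (momd s u v w 1 2 1 + (- 2%:R * c) * momd s u v w 2 1 1
   + c ^+ 2 * momd s u v w 3 0 1).
  by rewrite /momd /mom -!integZ -!integD; apply: eq_integ => p; rewrite dot_lcl; ring.
by rewrite M211 M301 -/a; ring.
Qed.

Lemma factor_binary_quadratic (c0 c1 c2 : K) : (c0, c1, c2) != (0, 0, 0) ->
  (exists al be ga de, al * de - be * ga != 0 /\ forall x y,
     c2 * x ^+ 2 + c1 * (x * y) + c0 * y ^+ 2 = (al * x + be * y) * (ga * x + de * y)) \/
  (exists al be, (al, be) != (0, 0) /\ forall x y,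
     c2 * x ^+ 2 + c1 * (x * y) + c0 * y ^+ 2 = (al * x + be * y) ^+ 2).
Proof.
move=> nz.
have [c20 | nz2] := eqVneq c2 0.
  have [c10 | nz1] := eqVneq c1 0.
    have [r rE] := sqrt_exists c0; right; exists 0, r; split.
      apply: contra_neq nz => -[r0]; rewrite c20 c10; congr (_, _, _).
      by rewrite -rE r0 expr0n.
    by move=> x y; rewrite c20 c10 -rE; ring.
  left; exists 0, 1, c1, c0; split; first by rewrite mul0r sub0r mul1r oppr_eq0.
  by move=> x y; rewrite c20; ring.
have nat_neq0 := natK_neq0 charK0.
have [d dE] := sqrt_exists (c1 ^+ 2 - 4%:R * c2 * c0).
have [r rE] := sqrt_exists c2.
have nzr : r != 0 by apply: contraNneq nz2 => r0; rewrite -rE r0 expr0n.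
have [d0 | nzd] := eqVneq d 0.
  right; exists r, (c1 / (2%:R * r)); split.
    by apply: contra_neq nzr => -[].
  move=> x y; have -> : c0 = c1 ^+ 2 / (4%:R * c2).
    have : c1 ^+ 2 = 4%:R * c2 * c0 by apply/eqP; rewrite -subr_eq0 -dE d0 expr0n.
    by move=> ->; field; rewrite nz2 nat_neq0.
  by rewrite -rE; field; rewrite nzr !nat_neq0.
left; exists c2, ((c1 - d) / 2%:R), 1, ((c1 + d) / (2%:R * c2)); split.
  suff -> : c2 * ((c1 + d) / (2%:R * c2)) - (c1 - d) / 2%:R * 1 = d by [].
  by field; rewrite nz2 nat_neq0.
move=> x y; have -> : c0 = (c1 ^+ 2 - d ^+ 2) / (4%:R * c2).
  by rewrite dE; field; rewrite nz2 nat_neq0.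
by field; rewrite nz2 !nat_neq0.
Qed.

Lemma exists_orthogonal3 (a b : vec) :
  exists2 c : vec, c != (0, 0, 0) & dot a c = 0 /\ dot b c = 0.
Proof.
pose A := \matrix_(i < 3, j < 2)
  (nth 0 (if j == 0 then [:: a.1.1; a.1.2; a.2] else [:: b.1.1; b.1.2; b.2]) i).
have : kermx A != 0.
  rewrite kermx_eq0 -row_leq_rank -ltnNge.
  exact: leq_ltn_trans (rank_leq_col A) _.
case/rowV0Pn => r /sub_kermxP rA0 nzr.
pose c : vec := (r 0 0, r 0 1, r 0 2%:R).
have colA j : \sum_i r 0 i * A i j = 0.
  by have /matrixP/(_ 0 j) := rA0; rewrite !mxE.
have i1 : lift ord0 ord0 = 1 :> 'I_3 by apply: val_inj.
have i2 : lift ord0 (lift ord0 ord0) = 2%:R :> 'I_3 by apply: val_inj.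
exists c; last first.
  split; [move: (colA 0) | move: (colA 1)];
    rewrite !big_ord_recl big_ord0 !mxE /= i1 i2 => E;
    by rewrite /dot /= -[RHS]E; ring.
apply: contraNneq nzr => -[c0 c1 c2]; apply/eqP/rowP => i; rewrite mxE.
by case: i => [[|[|[|i]]] lti] //; [rewrite -c0 | rewrite -c1 | rewrite -c2];
  congr (r 0 _); apply: val_inj.
Qed.

(** Two linear conditions on three coefficients leave a nonzero binary quadratic apolar to the cubic
    factor. If it has independent factors, taken as coordinates, the cubic becomes a combination of
    x^3 and y^3; if it is a square, of x y^2 and y^3. *)
Lemma vrank_double_line s u v w : det3 u v w != 0 ->
  apolar s (fun p => dot w p ^+ 2) -> vrank_le 7 s.
Proof.
move=> nz apo.
have [[[c0 c1] c2] nzc [cv cu]] := exists_orthogonal3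
  (momd s u v w 0 3 1, momd s u v w 1 2 1, momd s u v w 2 1 1)
  (momd s u v w 1 2 1, momd s u v w 2 1 1, momd s u v w 3 0 1).
rewrite /dot /= in cv cu.
have lin x y : integ s (fun p => (c2 * dot u p ^+ 2 + c1 * (dot u p * dot v p)
     + c0 * dot v p ^+ 2) * (x * dot u p + y * dot v p) * dot w p) = 0.
  rewrite -[RHS](mulr0 x) -{1}cu -[RHS]addr0 -[X in _ + X](mulr0 y) -{1}cv.
  transitivity (x * c0 * momd s u v w 1 2 1 + x * c1 * momd s u v w 2 1 1
    + x * c2 * momd s u v w 3 0 1 + y * c0 * momd s u v w 0 3 1
    + y * c1 * momd s u v w 1 2 1 + y * c2 * momd s u v w 2 1 1); last by ring.
  by rewrite /momd /mom -!integZ -!integD; apply: eq_integ => p; ring.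
have detE al be ga de : det3 (lc al u be v 0 w) (lc ga u de v 0 w) w =
    (al * de - be * ga) * det3 u v w by rewrite /det3 /dot /cross /=; ring.
have dotE al be p : dot (lc al u be v 0 w) p = al * dot u p + be * dot v p.
  by rewrite dot_lcl; ring.
case: (factor_binary_quadratic nzc) => [[al [be [ga [de [nzd facE]]]]] | [al [be [nzab facE]]]].
  have nzUV : det3 (lc al u be v 0 w) (lc ga u de v 0 w) w != 0 by rewrite detE mulf_neq0.
  apply: (vrank_double_line_xy nzUV apo).
    rewrite -[RHS](lin al be); apply: eq_integ => p; rewrite facE !dotE; ring.
  by rewrite -[RHS](lin ga de); apply: eq_integ => p; rewrite facE !dotE; ring.
have [ga [de nzd]] : exists ga de, al * de - be * ga != 0.
  have [al0 | nzal] := eqVneq al 0; last first.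
    by exists 0, 1; rewrite mulr1 mulr0 subr0.
  exists 1, 0; rewrite mulr0 sub0r mulr1 oppr_eq0.
  by apply: contra_neq nzab => ->; rewrite al0.
have nzUV : det3 (lc al u be v 0 w) (lc ga u de v 0 w) w != 0 by rewrite detE mulf_neq0.
apply: (vrank_double_line_xx nzUV apo).
  by rewrite -[RHS](lin al be); apply: eq_integ => p; rewrite facE !dotE; ring.
by rewrite -[RHS](lin ga de); apply: eq_integ => p; rewrite facE !dotE; ring.
Qed.

Lemma complete_basis a b : cross a b != (0, 0, 0) -> exists c, det3 a b c != 0.
Proof.
case E: (cross a b) => [[x y] z] nz.
have detE c : det3 a b c = dot c (cross a b) by rewrite /det3 /dot /cross /=; ring.
have [x0 | nzx] := eqVneq x 0; last first.
  by exists (1, 0, 0); rewrite detE E /dot /= !mul0r mul1r !addr0.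
have [y0 | nzy] := eqVneq y 0; last first.
  by exists (0, 1, 0); rewrite detE E /dot /= !mul0r mul1r add0r addr0.
exists (0, 0, 1); rewrite detE E /dot /= !mul0r mul1r !add0r.
by apply: contra_neq nz => ->; rewrite x0 y0.
Qed.

Lemma exists_noncollinear a : a != (0, 0, 0) -> exists b, cross a b != (0, 0, 0).
Proof.
case: a => [[x y] z] nz.
have [x0 | nzx] := eqVneq x 0; last first.
  exists (0, 1, 0); rewrite /cross /=.
  by apply: contra_neq nzx => -[_ _]; rewrite mulr0 subr0 mulr1.
have [y0 | nzy] := eqVneq y 0; last first.
  exists (1, 0, 0); rewrite /cross /=.
  by apply: contra_neq nzy => -[_ _]; rewrite mulr0 mulr1 sub0r => /eqP; rewrite oppr_eq0 => /eqP.
exists (1, 0, 0); rewrite /cross /=.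
by apply: contra_neq nz => -[_]; rewrite x0 y0 mulr0 mulr1 subr0 => ->.
Qed.

Lemma collinear a b : a != (0, 0, 0) -> cross a b = (0, 0, 0) ->
  exists c, forall p, dot b p = c * dot a p.
Proof.
case: a b => [[x y] z] [[x' y'] z'] nz; rewrite /cross /dot /= => -[E1 E2 E3].
have eqC (r t : K) : r - t = 0 -> r = t by move/eqP; rewrite subr_eq0 => /eqP.
have [x0 | nzx] := eqVneq x 0; last first.
  exists (x' / x) => p; rewrite -[y'](mulKf nzx) -[z'](mulKf nzx).
  by rewrite (eqC _ _ E3) -(eqC _ _ E2); field.
have [y0 | nzy] := eqVneq y 0; last first.
  exists (y' / y) => p; rewrite -[x'](mulKf nzy) -[z'](mulKf nzy).
  by rewrite -(eqC _ _ E3) (eqC _ _ E1); field.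
have nzz : z != 0 by apply: contra_neq nz => ->; rewrite x0 y0.
exists (z' / z) => p; rewrite -[x'](mulKf nzz) -[y'](mulKf nzz).
by rewrite (eqC _ _ E2) -(eqC _ _ E1); field.
Qed.

Lemma vrank_apolar_product s a b : a != (0, 0, 0) -> b != (0, 0, 0) ->
  apolar s (fun p => dot a p * dot b p) -> vrank_le 7 s.
Proof.
move=> nza nzb apo; have [ab0 | nzab] := eqVneq (cross a b) (0, 0, 0); last first.
  by have [c nz] := complete_basis nzab; apply: (vrank_two_lines7 charK0 nz apo).
have [c bE] := collinear nza ab0.
have nzc : c != 0.
  apply: contra_neq nzb => c0; case: b bE {apo ab0} => [[x y] z] bE.
  have := bE (1, 0, 0); have := bE (0, 1, 0); have := bE (0, 0, 1).
  by rewrite c0 /dot /= !mul0r !mulr1 !mulr0 !add0r !addr0 => -> -> ->.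
have [b' nzb'] := exists_noncollinear nza; have [d nz] := complete_basis nzb'.
apply: (@vrank_double_line s b' d a); first by rewrite det3_rot.
move=> e f; rewrite -[RHS](mulr0 c^-1) -(apo e f) -integZ; apply: eq_integ => p.
by rewrite bE; field.
Qed.

End SingularConics.

(** * Conics *)

Section Conics.
Variable K : closedFieldType.
Hypothesis charK0 : [pchar K] =i pred0.
Local Notation vec := (vec K).
Implicit Types (s : seq (K * vec)) (u v w a b c d p : vec) (Q R S : 'rV[K]_6).

(** Conics are rows of coefficients of x^2, xy, xz, y^2, yz, z^2. This is the polarized Veronese
    vector of two points, with halved mixed entries, whereas [prodform] holds the coefficients of a
    product of two linear forms. *)
Definition sym2 a b : 'rV[K]_6 := \row_i nth 0
  [:: a.1.1 * b.1.1; (a.1.1 * b.1.2 + a.1.2 * b.1.1) / 2%:R;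
      (a.1.1 * b.2 + a.2 * b.1.1) / 2%:R; a.1.2 * b.1.2;
      (a.1.2 * b.2 + a.2 * b.1.2) / 2%:R; a.2 * b.2] i.

Definition prodform a b : 'rV[K]_6 := \row_i nth 0
  [:: a.1.1 * b.1.1; a.1.1 * b.1.2 + a.1.2 * b.1.1;
      a.1.1 * b.2 + a.2 * b.1.1; a.1.2 * b.1.2;
      a.1.2 * b.2 + a.2 * b.1.2; a.2 * b.2] i.

Definition polar Q a b : K := (Q *m (sym2 a b)^T) 0 0.
Definition qf Q p : K := polar Q p p.

Let nat_neq0 := natK_neq0 charK0.

Lemma sym2C a b : sym2 a b = sym2 b a.
Proof.
by apply/rowP => i; rewrite !mxE; case: i => [[|[|[|[|[|[|i]]]]]] lti] //=; ring.
Qed.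

Lemma sym2_lc x a y b z c d :
  sym2 (lc x a y b z c) d = x *: sym2 a d + y *: sym2 b d + z *: sym2 c d.
Proof.
by apply/rowP => i; rewrite !mxE;
   case: i => [[|[|[|[|[|[|i]]]]]] lti] //=; ring.
Qed.

Lemma polarC Q a b : polar Q a b = polar Q b a.
Proof. by rewrite /polar sym2C. Qed.

Lemma polar_lcl Q x a y b z c d :
  polar Q (lc x a y b z c) d = x * polar Q a d + y * polar Q b d + z * polar Q c d.
Proof. by rewrite /polar sym2_lc !linearD !linearZ /= !mxE. Qed.

Lemma polar_lcr Q x a y b z c d :
  polar Q d (lc x a y b z c) = x * polar Q d a + y * polar Q d b + z * polar Q d c.
Proof. by rewrite polarC polar_lcl !(polarC _ d). Qed.

Lemma polarD Q R a b : polar (Q + R) a b = polar Q a b + polar R a b.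
Proof. by rewrite /polar mulmxDl mxE. Qed.

Lemma polarZ x Q a b : polar (x *: Q) a b = x * polar Q a b.
Proof. by rewrite /polar -scalemxAl mxE. Qed.

Lemma qf_prodform a b p : qf (prodform a b) p = dot a p * dot b p.
Proof.
rewrite /qf /polar mxE !big_ord_recl big_ord0 !mxE /= /dot.
by field; rewrite nat_neq0.
Qed.

Lemma qf_eq0 Q : (forall p, qf Q p = 0) -> Q = 0.
Proof.
move=> Q0.
have E (x y z : K) : Q 0 0 * (x * x) + Q 0 1 * (x * y) + Q 0 2%:R * (x * z)
   + Q 0 3%:R * (y * y) + Q 0 4%:R * (y * z) + Q 0 5%:R * (z * z) = 0.
  rewrite -[RHS](Q0 (x, y, z)) /qf /polar mxE !big_ord_recl big_ord0 !mxE /=.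
  have -> : ord0 = 0 :> 'I_6 by [].
  have -> : lift ord0 ord0 = 1 :> 'I_6 by apply: val_inj.
  have -> : lift ord0 (lift ord0 ord0) = 2%:R :> 'I_6 by apply: val_inj.
  have -> : lift ord0 (lift ord0 (lift ord0 ord0)) = 3%:R :> 'I_6 by apply: val_inj.
  have -> : lift ord0 (lift ord0 (lift ord0 (lift ord0 ord0))) = 4%:R :> 'I_6 by apply: val_inj.
  have -> : lift ord0 (lift ord0 (lift ord0 (lift ord0 (lift ord0 ord0)))) = 5%:R :> 'I_6 by apply: val_inj.
  by field; rewrite nat_neq0.
have q0 : Q 0 0 = 0 by rewrite -[RHS](E 1 0 0); ring.
have q3 : Q 0 3%:R = 0 by rewrite -[RHS](E 0 1 0); ring.
have q5 : Q 0 5%:R = 0 by rewrite -[RHS](E 0 0 1); ring.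
have q1 : Q 0 1 = 0 by rewrite -[RHS](E 1 1 0) q0 q3; ring.
have q2 : Q 0 2%:R = 0 by rewrite -[RHS](E 1 0 1) q0 q5; ring.
have q4 : Q 0 4%:R = 0 by rewrite -[RHS](E 0 1 1) q3 q5; ring.
apply/rowP => i; rewrite mxE; case: i => [[|[|[|[|[|[|i]]]]]] lti] //.
- by rewrite -q0; congr (Q 0 _); apply: val_inj.
- by rewrite -q1; congr (Q 0 _); apply: val_inj.
- by rewrite -q2; congr (Q 0 _); apply: val_inj.
- by rewrite -q3; congr (Q 0 _); apply: val_inj.
- by rewrite -q4; congr (Q 0 _); apply: val_inj.
by rewrite -q5; congr (Q 0 _); apply: val_inj.
Qed.

Lemma dot_neq0 a p : dot a p != 0 -> a != (0, 0, 0).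
Proof. by apply: contra_neq => ->; rewrite /dot /= !mul0r !addr0. Qed.

Lemma exists_orthogonal_pair p : p != (0, 0, 0) ->
  exists a b, [/\ dot a p = 0, dot b p = 0 &
    exists2 k, k != 0 & forall c, det3 c a b = k * dot c p].
Proof.
case: p => [[x y] z] nz; rewrite /det3 /dot /cross /=.
have [x0 | nzx] := eqVneq x 0; last first.
  exists (- y, x, 0), (- z, 0, x); split; [by simpl; ring | by simpl; ring |].
  by exists x => // c; simpl; ring.
have [y0 | nzy] := eqVneq y 0; last first.
  exists (y, - x, 0), (0, - z, y); split; [by simpl; ring | by simpl; ring |].
  by exists (- y) => [|c]; rewrite ?oppr_eq0 //; simpl; ring.
have nzz : z != 0 by apply: contra_neq nz => ->; rewrite x0 y0.
exists (z, 0, - x), (0, z, - y); split; [by simpl; ring | by simpl; ring |].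
by exists z => // c; simpl; ring.
Qed.

(* Completing the square: [Q = L^2 + Q'] with [Q'] a form in two variables. *)
Lemma conic_normal_form Q : Q != 0 ->
  (exists a b, [/\ a != (0, 0, 0), b != (0, 0, 0) & forall p, qf Q p = dot a p * dot b p]) \/
  (exists u v w, det3 u v w != 0 /\
     forall p, qf Q p = dot u p * dot w p - dot v p ^+ 2).
Proof.
move=> nzQ.
have [e nze] : exists e, qf Q e != 0.
  apply: NNPP => noe; case/eqP: nzQ; apply: qf_eq0 => p; apply/eqP.
  by apply/negPn/negP => nzp; apply: noe; exists p.
have [r rE] := sqrt_exists (qf Q e).
have nzr : r != 0 by apply: contraNneq nze => r0; rewrite -rE r0 expr0n.
(* The polar line of [e], scaled so that the square of [L] agrees with [Q] at [e]. *)
pose L : vec := (polar Q e (1, 0, 0) / r, polar Q e (0, 1, 0) / r, polar Q e (0, 0, 1) / r).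
have LE p : dot L p = polar Q e p / r.
  have {2}-> : p = lc p.1.1 (1, 0, 0) p.1.2 (0, 1, 0) p.2 (0, 0, 1).
    case: p => [[x y] z]; rewrite /lc /=; congr (_, _, _); ring.
  by rewrite polar_lcr /dot /L /=; field.
have Le : dot L e = r by rewrite LE -/(qf Q e) -rE expr2 mulfK.
have nze3 : e != (0, 0, 0).
  by apply: contra_neq nzr => e0; rewrite -Le e0 /dot /= !mulr0 !addr0.
have [M [N [Me Ne [k nzk detE]]]] := exists_orthogonal_pair nze3.
have nzd : det3 L M N != 0 by rewrite detE mulf_neq0 // Le.
set D := det3 L M N in nzd.
(* The vectors [e / r], [m], [n] form the basis dual to [L], [M], [N]. *)
pose m := lc D^-1 (cross N L) 0 e 0 e; pose n := lc D^-1 (cross L M) 0 e 0 e.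
have decp p : p = lc (dot L p / r) e (dot M p) m (dot N p) n.
  have dec (q : vec) : q = lc (dot L q / D) (cross M N) (dot M q / D) (cross N L)
                              (dot N q / D) (cross L M).
    case: q => [[x y] z]; rewrite /lc /=; congr (_, _, _);
      by rewrite -[LHS](mulKf nzd) {2}/D /det3 /dot /cross /=; ring.
  rewrite {1}[p]dec {1}[e]dec Le Me Ne /m /n /lc /=.
  by congr (_, _, _); field; rewrite nzr nzd.
have Lm : dot L m = 0 by rewrite /m dot_lcr /dot /cross /=; ring.
have Ln : dot L n = 0 by rewrite /n dot_lcr /dot /cross /=; ring.
have polem : polar Q e m = 0 by move: (LE m); rewrite Lm => /esym/eqP; rewrite mulf_eq0 invr_eq0 (negbTE nzr) orbF => /eqP.
have polen : polar Q e n = 0 by move: (LE n); rewrite Ln => /esym/eqP; rewrite mulf_eq0 invr_eq0 (negbTE nzr) orbF => /eqP.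
clearbody m n.
have qE p : qf Q p = dot L p ^+ 2 + (qf Q m * dot M p ^+ 2
    + 2%:R * polar Q m n * (dot M p * dot N p) + qf Q n * dot N p ^+ 2).
  rewrite {1}[p]decp /qf !polar_lcl !polar_lcr -!/(qf Q _) -rE.
  by rewrite (polarC Q m e) (polarC Q n e) (polarC Q n m) polem polen; field.
have [/eqP[c0 c1 c2] | nzc] := boolP ((qf Q n, 2%:R * polar Q m n, qf Q m) == (0, 0, 0)).
  left; exists L, L; split; rewrite ?(@dot_neq0 L e) ?Le // => p.
  by rewrite qE c0 c1 c2; ring.
case: (factor_binary_quadratic charK0 nzc) => [[al [be [ga [de [nzg facE]]]]] | [al [be [nzab facE]]]].
  have [i iE] := sqrt_exists (- 1 : K).
  have nzi : i != 0 by apply: contra_eq_neq iE => ->; rewrite expr0n eq_sym oppr_eq0 oner_eq0.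
  right; exists (lc 0 L al M be N), (lc i L 0 M 0 N), (lc 0 L ga M de N); split.
    have -> : det3 (lc 0 L al M be N) (lc i L 0 M 0 N) (lc 0 L ga M de N) =
      - (i * ((al * de - be * ga) * D)) by rewrite /D /det3 /dot /cross /=; ring.
    by rewrite oppr_eq0 !mulf_neq0.
  move=> p; rewrite qE facE !dot_lcl.
  have -> : (i * dot L p + 0 * dot M p + 0 * dot N p) ^+ 2 = i ^+ 2 * dot L p ^+ 2 by ring.
  by rewrite iE; ring.
(* A sum of two squares L^2 + S^2 splits as (L + i S)(L - i S). *)
have [i iE] := sqrt_exists (- 1 : K).
left; exists (lc 1 L (i * al) M (i * be) N), (lc 1 L (- (i * al)) M (- (i * be)) N); split.
- by apply: (@dot_neq0 _ e); rewrite dot_lcl Le Me Ne !mulr0 !addr0 mul1r.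
- by apply: (@dot_neq0 _ e); rewrite dot_lcl Le Me Ne !mulr0 !addr0 mul1r.
move=> p; rewrite qE facE !dot_lcl.
transitivity (dot L p ^+ 2 - i ^+ 2 * (al * dot M p + be * dot N p) ^+ 2); last by ring.
by rewrite iE; ring.
Qed.

End Conics.

(** * The upper bound *)

Section Catalecticant.
Variable K : closedFieldType.
Hypothesis charK0 : [pchar K] =i pred0.
Local Notation vec := (vec K).
Implicit Types (s : seq (K * vec)) (u v w a b c d p : vec) (Q R S : 'rV[K]_6).

Let nat_neq0 := natK_neq0 charK0.

Definition catalecticant s : 'M[K]_6 :=
  \sum_(x <- s) x.1 *: ((sym2 x.2 x.2)^T *m sym2 x.2 x.2).

Lemma catalecticantE s Q R :
  (Q *m catalecticant s *m R^T) 0 0 = integ s (fun p => qf Q p * qf R p).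
Proof.
rewrite /catalecticant /integ mulmx_sumr mulmx_suml summxE; apply: eq_bigr => x _.
rewrite -scalemxAr -scalemxAl mxE; congr (_ * _).
set N := sym2 _ _.
have -> : Q *m (N^T *m N) *m R^T = (Q *m N^T) *m (N *m R^T) by rewrite !mulmxA.
rewrite mxE big_ord1; congr (_ * _).
by rewrite /qf /polar !mxE; apply: eq_bigr => i _; rewrite !mxE mulrC.
Qed.

Lemma catalecticant_sym s : (catalecticant s)^T = catalecticant s.
Proof.
rewrite /catalecticant linear_sum; apply: eq_bigr => x _.
by rewrite linearZ /= trmx_mul trmxK.
Qed.

Lemma apolar_kernel s Q : Q *m catalecticant s = 0 -> apolar s (qf Q).
Proof.
move=> Q0 a b; transitivity (integ s (fun p => qf Q p * qf (prodform a b) p)).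
  by apply: eq_integ => p; rewrite qf_prodform.
by rewrite -catalecticantE Q0 mul0mx mxE.
Qed.

Lemma eq_row_dot n (X Y : 'rV[K]_n) : (forall R : 'rV_n, (X *m R^T) 0 0 = (Y *m R^T) 0 0) -> X = Y.
Proof.
move=> eqXY; apply/rowP => j; have := eqXY (delta_mx 0 j).
by rewrite trmx_delta -!colE !mxE.
Qed.

(** Each coordinate is the contraction with a quadratic monomial, which is a product of two
    coordinate forms. *)
Lemma kernel_apolar s Q : apolar s (qf Q) -> Q *m catalecticant s = 0.
Proof.
move=> apo; pose e i : vec := nth (0, 0, 0) [:: (1, 0, 0); (0, 1, 0); (0, 0, 1)] i.
apply/rowP => j; rewrite [RHS]mxE.
have -> : (Q *m catalecticant s) 0 j = (Q *m catalecticant s *m (delta_mx 0 j : 'rV_6)^T) 0 0.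
  by rewrite trmx_delta -colE [RHS]mxE.
rewrite catalecticantE.
have prodE a b : delta_mx 0 j = prodform a b :> 'rV[K]_6 ->
    integ s (fun p => qf Q p * qf (delta_mx 0 j : 'rV_6) p) = 0.
  by move=> ->; rewrite -[RHS](apo a b); apply: eq_integ => p; rewrite qf_prodform.
have deltaE a b (k : nat) : j = k :> nat -> (forall i : 'I_6, prodform a b 0 i = (i == k :> nat)%:R) ->
    delta_mx 0 j = prodform a b :> 'rV[K]_6.
  by move=> jk E; apply/rowP => i; rewrite E mxE -jk.
case: j prodE deltaE => [[|[|[|[|[|[|j]]]]]] ltj] prodE deltaE //.
- apply: (prodE (e 0%N) (e 0%N)); apply: (deltaE _ _ 0%N) => // -[[|[|[|[|[|[|i]]]]]] lti] //;
    rewrite mxE /=; ring.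
- apply: (prodE (e 0%N) (e 1%N)); apply: (deltaE _ _ 1%N) => // -[[|[|[|[|[|[|i]]]]]] lti] //;
    rewrite mxE /=; ring.
- apply: (prodE (e 0%N) (e 2%N)); apply: (deltaE _ _ 2%N) => // -[[|[|[|[|[|[|i]]]]]] lti] //;
    rewrite mxE /=; ring.
- apply: (prodE (e 1%N) (e 1%N)); apply: (deltaE _ _ 3%N) => // -[[|[|[|[|[|[|i]]]]]] lti] //;
    rewrite mxE /=; ring.
- apply: (prodE (e 1%N) (e 2%N)); apply: (deltaE _ _ 4%N) => // -[[|[|[|[|[|[|i]]]]]] lti] //;
    rewrite mxE /=; ring.
apply: (prodE (e 2%N) (e 2%N)); apply: (deltaE _ _ 5%N) => // -[[|[|[|[|[|[|i]]]]]] lti] //;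
    rewrite mxE /=; ring.
Qed.

Definition only_apolar s Q := forall R, apolar s (qf R) -> exists k, R = k *: Q.

Lemma qfD Q R p : qf (Q + R) p = qf Q p + qf R p.
Proof. exact: polarD. Qed.

Lemma qfZ x Q p : qf (x *: Q) p = x * qf Q p.
Proof. exact: polarZ. Qed.

(** A multiple of u w - v^2 without a term u w is 0, which gives the independence required by
    [vrank_smooth]. *)
Lemma vrank_only_smooth s Q u v w : det3 u v w != 0 -> apolar s (qf Q) ->
    only_apolar s Q -> (forall p, qf Q p = dot u p * dot w p - dot v p ^+ 2) ->
  vrank_le 5 s.
Proof.
move=> nz apo only QE.
apply: (vrank_smooth charK0 nz); first exact: eq_apolar apo.
move=> h0 h1 h2 h3 h4; pose R := h0 *: prodform u u + h1 *: prodform u v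
  + h2 *: prodform v v + h3 *: prodform v w + h4 *: prodform w w.
have RE p : qf R p = h0 * dot u p ^+ 2 + h1 * (dot u p * dot v p)
   + h2 * dot v p ^+ 2 + h3 * (dot v p * dot w p) + h4 * dot w p ^+ 2.
  by rewrite !qfD !qfZ !(qf_prodform charK0); ring.
move=> /(eq_apolar (fun p => esym (RE p)))/only[k Rk].
have E x y z : h0 * x ^+ 2 + h1 * (x * y) + h2 * y ^+ 2 + h3 * (y * z) + h4 * z ^+ 2
    = k * (x * z - y ^+ 2).
  have [p [<- <- <-]] := dual_point x y z nz.
  by rewrite -RE Rk qfZ QE.
have h00 : h0 = 0 by transitivity (k * (1 * 0 - 0 ^+ 2)); [rewrite -(E 1 0 0); ring | ring].
have h40 : h4 = 0 by transitivity (k * (0 * 1 - 0 ^+ 2)); [rewrite -(E 0 0 1); ring | ring].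
have k0 : k = 0.
  by transitivity (k * (1 * 1 - 0 ^+ 2)); [ring | rewrite -(E 1 0 1) h00 h40; ring].
rewrite k0 in E.
have h20 : h2 = 0 by transitivity (0 * (0 * 0 - 1 ^+ 2) : K); [rewrite -(E 0 1 0); ring | ring].
have h10 : h1 = 0 by transitivity (0 * (1 * 0 - 1 ^+ 2) : K); [rewrite -(E 1 1 0) h00 h20; ring | ring].
have h30 : h3 = 0 by transitivity (0 * (0 * 1 - 1 ^+ 2) : K); [rewrite -(E 0 1 1) h40 h20; ring | ring].
by split.
Qed.

(** The minor excludes squares of lines. If [Q] is a product of lines [a] and [b], an exceptional
    binary summand would make the square of one of them apolar, and this is no multiple of [Q]. *)
Lemma vrank_only_nonsquare s Q : Q != 0 -> apolar s (qf Q) -> only_apolar s Q ->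
    (exists x y, qf Q x * qf Q y != polar Q x y ^+ 2) ->
  vrank_le 6 s.
Proof.
move=> nzQ apo only [x [y minor]].
case: (conic_normal_form charK0 nzQ) => [[a [b [nza nzb QE]]] | [u [v [w [nz QE]]]]]; last first.
  by apply: (@vrank_le_widen _ 5) => //; apply: (vrank_only_smooth nz apo only QE).
have polE z t : 2%:R * polar Q z t = dot a z * dot b t + dot a t * dot b z.
  have := QE (lc 1 z 1 t 0 z); rewrite {1}/qf polar_lcl !polar_lcr -!/(qf Q _) !QE (polarC Q t z).
  rewrite !dot_lcr => E; transitivity
    (((1 * (1 * (dot a z * dot b z) + 1 * polar Q z t + 0 * (dot a z * dot b z))
     + 1 * (1 * polar Q z t + 1 * (dot a t * dot b t) + 0 * polar Q z t)
     + 0 * (1 * (dot a z * dot b z) + 1 * polar Q z t + 0 * (dot a z * dot b z))))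
     - dot a z * dot b z - dot a t * dot b t); first ring.
  by rewrite E; ring.
have [ab0 | nzab] := eqVneq (cross a b) (0, 0, 0).
  have [c bE] := collinear nza ab0; case/negP: minor; apply/eqP.
  have -> : polar Q x y = c * (dot a x * dot a y).
    by apply: (mulfI (nat_neq0 1)); rewrite polE !bE; ring.
  by rewrite !QE !bE; ring.
have [c nz] := complete_basis nzab.
have apo' : apolar s (fun p => dot a p * dot b p) by apply: eq_apolar apo.
have not_square f : apolar s (fun p => dot f p ^+ 2) ->
    (exists p, dot f p = 1 /\ dot a p * dot b p = 0) -> False.
  move=> apof [p [f1 ab]]; have /only[k Rk] : apolar s (qf (prodform f f)).
    by apply: eq_apolar apof => z; rewrite (qf_prodform charK0) expr2.
  have := qf_prodform charK0 f f p; rewrite Rk qfZ QE ab f1 mulr0 mulr1 => /esym/eqP.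
  by rewrite oner_eq0.
have [[M310 M220 M211] [M130 M121 M112]] := product_moments c apo'.
have zeros := (M310, M220, M211, M130, M121, M112).
apply: (vrank_two_lines6 charK0 nz apo') => -[E1 E2 E3].
  apply: (not_square a); last first.
    by have [p [ap bp _]] := dual_point 1 0 0 nz; exists p; rewrite bp mulr0.
  by apply: (@apolar_moments _ s a b c nz _ 1 0 0 0 0 0); first (by move=> p; ring);
    rewrite ?zeros ?E1 ?E2 ?E3; ring.
apply: (not_square b); last first.
  by have [p [ap bp _]] := dual_point 0 1 0 nz; exists p; rewrite ap mul0r.
by apply: (@apolar_moments _ s a b c nz _ 0 0 0 1 0 0); first (by move=> p; ring);
  rewrite ?zeros ?E1 ?E2 ?E3; ring.
Qed.

Lemma factor_quartic (h0 h1 h2 h3 h4 : K) : exists a0 a1 a2 b0 b1 b2 : K,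
  [/\ a0 * b0 = h0, a0 * b1 + a1 * b0 = h1, a0 * b2 + a1 * b1 + a2 * b0 = h2,
      a1 * b2 + a2 * b1 = h3 & a2 * b2 = h4].
Proof.
pose p := Poly [:: h0; h1; h2; h3; h4].
have [p0 | nzp] := eqVneq p 0.
  have pE i : nth 0 [:: h0; h1; h2; h3; h4] i = 0 by rewrite -coef_Poly -/p p0 coef0.
  exists 0, 0, 0, 0, 0, 0; rewrite !mulr0 !addr0.
  by split; [have := pE 0%N | have := pE 1%N | have := pE 2%N | have := pE 3%N | have := pE 4%N].
have [r defp] := closed_field_poly_normal p.
have szr : (size r <= 4)%N.
  have : (size p <= 5)%N by apply: size_Poly.
  by rewrite defp size_scale ?lead_coef_eq0 // size_prod_XsubC.
pose A := lead_coef p *: \prod_(z <- take 2 r) ('X - z%:P).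
pose B := \prod_(z <- drop 2 r) ('X - z%:P).
have pAB : p = A * B by rewrite {1}defp -{1}(cat_take_drop 2 r) big_cat /= scalerAl.
have szA : (size A <= 3)%N.
  rewrite (leq_trans (size_scale_leq _ _)) // size_prod_XsubC size_take ltnS.
  by case: ltnP => // /ltnW.
have szB : (size B <= 3)%N by rewrite size_prod_XsubC size_drop ltnS leq_subLR.
have A0 i : (3 <= i)%N -> A`_i = 0 by move=> lei; rewrite nth_default // (leq_trans szA).
have B0 i : (3 <= i)%N -> B`_i = 0 by move=> lei; rewrite nth_default // (leq_trans szB).
have pE i : nth 0 [:: h0; h1; h2; h3; h4] i = \sum_(j < i.+1) A`_j * B`_(i - j).
  by rewrite -coef_Poly -/p pAB coefM.
exists A`_0, A`_1, A`_2, B`_0, B`_1, B`_2.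
split; [have := pE 0%N | have := pE 1%N | have := pE 2%N | have := pE 3%N | have := pE 4%N];
  rewrite !big_ord_recl big_ord0 /= ?subn0 ?(A0 3%N) ?(A0 4%N) ?(B0 3%N) ?(B0 4%N) // => ->;
  rewrite /bump /=; rewrite ?(A0 3%N) ?(A0 4%N) //; try ring.
Qed.

(** If a second conic [R] is apolar besides a smooth [Q], its restriction to the parametrization (1,
    t, t^2) of [Q] is a product of two quadratics, the restrictions of lines [A] and [B]. Their
    product differs from [R] by a multiple of [Q], hence is apolar. *)
Lemma vrank_apolar s Q : Q != 0 -> apolar s (qf Q) -> vrank_le 7 s.
Proof.
move=> nzQ apo.
case: (conic_normal_form charK0 nzQ) => [[a [b [nza nzb QE]]] | [u [v [w [nz QE]]]]].
  by apply: (vrank_apolar_product charK0 nza nzb); apply: eq_apolar apo.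
have [only | notonly] := classic (only_apolar s Q).
  by apply: (@vrank_le_widen _ 5) => //; apply: (vrank_only_smooth nz apo only QE).
have [R [apoR notR]] : exists R, apolar s (qf R) /\ ~ exists k, R = k *: Q.
  by apply: NNPP => noR; apply: notonly => R apoR; apply: NNPP => notR; apply: noR; exists R.
pose d := det3 u v w; pose U := lc d^-1 (cross v w) 0 u 0 u.
pose V := lc d^-1 (cross w u) 0 u 0 u; pose W := lc d^-1 (cross u v) 0 u 0 u.
have decp p : p = lc (dot u p) U (dot v p) V (dot w p) W.
  case: p => [[x y] z]; rewrite /U /V /W /lc /=; congr (_, _, _);
  by rewrite -[LHS](mulKf nz) {2}/det3 -/d /dot /cross /=; ring.
clearbody U V W.
have RE p : qf R p = qf R U * dot u p ^+ 2 + 2%:R * polar R U V * (dot u p * dot v p)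
    + 2%:R * polar R U W * (dot u p * dot w p) + qf R V * dot v p ^+ 2
    + 2%:R * polar R V W * (dot v p * dot w p) + qf R W * dot w p ^+ 2.
  rewrite {1}[p]decp /qf !polar_lcl !polar_lcr.
  by rewrite (polarC R V U) (polarC R W U) (polarC R W V); ring.
have [a0 [a1 [a2 [b0 [b1 [b2 [E0 E1 E2 E3 E4]]]]]]] := factor_quartic (qf R U)
  (2%:R * polar R U V) (2%:R * polar R U W + qf R V) (2%:R * polar R V W) (qf R W).
pose A := lc a0 u a1 v a2 w; pose B := lc b0 u b1 v b2 w.
pose k := a0 * b2 + a2 * b0 - 2%:R * polar R U W.
have ABE p : qf (1 *: R + k *: Q) p = dot A p * dot B p.
  rewrite qfD !qfZ QE RE !dot_lcl -E0 -E1 -E3 -E4 /k.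
  have -> : qf R V = a0 * b2 + a1 * b1 + a2 * b0 - 2%:R * polar R U W by rewrite E2; ring.
  by ring.
have apoAB : apolar s (fun p => dot A p * dot B p).
  apply: (eq_apolar ABE); apply: (eq_apolar (fun p => esym _)) (apolar_lin 1 k apoR apo) => p.
  by rewrite qfD !qfZ.
have nzAB : 1 *: R + k *: Q != 0.
  apply/eqP => E; apply: notR; exists (- k); apply/eqP.
  by rewrite scaleNr -addr_eq0 -[R]scale1r E.
have nzAB' : A != (0, 0, 0) /\ B != (0, 0, 0).
  split; apply: contra_neq nzAB => F0; apply: (qf_eq0 charK0) => p;
    by rewrite ABE F0 /dot /= !mul0r !addr0 ?mulr0 ?mul0r.
by case: nzAB' => nzA nzB; apply: (vrank_apolar_product charK0 nzA nzB).
Qed.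

(** * Quartics with invertible catalecticant *)

Section Nondegenerate.
Variable s : seq (K * vec).
Hypothesis uC : catalecticant s \in unitmx.
Local Notation C := (catalecticant s).
Local Notation D := (invmx C).

(* [Q_p = sym2 p p *m D] is the conic whose contraction with the quartic is
   p^2, and [inv4 p p a b] is its polar form. *)
Definition inv4 a b c d : K := (sym2 a b *m D *m (sym2 c d)^T) 0 0.

Lemma inv4_sym a b c d : inv4 a b c d = inv4 c d a b.
Proof.
rewrite /inv4 -[in LHS](trmxK (_ *m _ *m _)) mxE !trmx_mul trmxK trmx_inv.
by rewrite catalecticant_sym mulmxA.
Qed.

Lemma inv4C a b c d : inv4 a b c d = inv4 b a c d.
Proof. by rewrite /inv4 sym2C. Qed.

Lemma inv4C2 a b c d : inv4 a b c d = inv4 a b d c.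
Proof. by rewrite /inv4 (sym2C c). Qed.

Lemma inv4_lc1 x a y b z c a' b' c' : inv4 (lc x a y b z c) a' b' c' =
  x * inv4 a a' b' c' + y * inv4 b a' b' c' + z * inv4 c a' b' c'.
Proof. by rewrite /inv4 sym2_lc !mulmxDl -!scalemxAl !mxE. Qed.

Lemma inv4_lc2 x a y b z c a' b' c' : inv4 a' (lc x a y b z c) b' c' =
  x * inv4 a' a b' c' + y * inv4 a' b b' c' + z * inv4 a' c b' c'.
Proof. by rewrite inv4C inv4_lc1 !(inv4C a'). Qed.

Lemma inv4_lc3 x a y b z c a' b' c' : inv4 a' b' (lc x a y b z c) c' =
  x * inv4 a' b' a c' + y * inv4 a' b' b c' + z * inv4 a' b' c c'.
Proof. by rewrite inv4_sym inv4_lc1 !(inv4_sym _ _ a' b'). Qed.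

Lemma inv4_lc4 x a y b z c a' b' c' : inv4 a' b' c' (lc x a y b z c) =
  x * inv4 a' b' c' a + y * inv4 a' b' c' b + z * inv4 a' b' c' c.
Proof. by rewrite inv4C2 inv4_lc3 !(inv4C2 _ _ c'). Qed.

Lemma inv4_polar a b c d : polar (sym2 a b *m D) c d = inv4 a b c d.
Proof. by []. Qed.

(** The identity [D *m C *m D = D], expanded over the points of [s]. *)
Lemma integ_inv4_mul a b c d :
  integ s (fun p => inv4 p p a b * inv4 p p c d) = inv4 a b c d.
Proof.
transitivity (integ s (fun p => qf (sym2 a b *m D) p * qf (sym2 c d *m D) p)).
  by apply: eq_integ => p; rewrite /qf !inv4_polar !(inv4_sym p p).
rewrite -catalecticantE trmx_mul trmx_inv catalecticant_sym mulmxKV //.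
by rewrite mulmxA.
Qed.

(** The sum is the trace of [D *m C], and the space of conics has dimension 6. *)
Lemma integ_inv4 : integ s (fun p => inv4 p p p p) = 6%:R.
Proof.
transitivity (\tr (D *m C)); last by rewrite mulVmx // mxtrace1.
rewrite /catalecticant mulmx_sumr raddf_sum; apply: eq_bigr => x _ /=.
rewrite -scalemxAr linearZ /=; congr (_ * _).
by rewrite mulmxA mxtrace_mulC mulmxA /mxtrace big_ord1.
Qed.

Lemma inv4_nonzero : exists p, inv4 p p p p != 0.
Proof.
apply: NNPP => none; have := natK_neq0 charK0 5; rewrite -integ_inv4 => /eqP[].
rewrite /integ big1 // => x _; suff -> : inv4 x.2 x.2 x.2 x.2 = 0 by rewrite mulr0.
by apply/eqP/negPn/negP => nz; apply: none; exists x.2.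
Qed.

(* If Q_p were the square of a linear form whenever Q_p(p) <> 0, then it would
   be so for every [p].  Integrating the resulting identities gives
   [inv4 p0 p0 b c = inv4 p0 b p0 c], and for a nonzero zero [b] of the linear
   form Q_p0(p0, .) this leads to [sym2 p0 b *m D = 0]. *)
Lemma exists_nonsquare : exists p, inv4 p p p p != 0 /\
  exists x y, inv4 p p x x * inv4 p p y y != inv4 p p x y ^+ 2.
Proof.
apply: NNPP => none; have [p0 nz0] := inv4_nonzero.
have sq p x y : inv4 p p x x * inv4 p p y y = inv4 p p x y ^+ 2.
  apply/eqP; rewrite -subr_eq0; apply/negPn/negP => nzm.
  (* On the line p + t p0, the diagonal value and the minor become polynomials [F] and [G] in t. [F]
     has a nonzero coefficient at t^4 and [G] is nonzero at t = 0, so some t keeps both nonzero,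
     against [none]. *)
  pose A a b : {poly K} := (inv4 p p a b)%:P + (2%:R * inv4 p0 p a b)%:P * 'X
                           + (inv4 p0 p0 a b)%:P * 'X^2.
  have hE := (hornerD, hornerN, hornerM, horner_exp, hornerX, hornerC).
  have AE t a b : (A a b).[t] = inv4 (lc t p0 1 p 0 p) (lc t p0 1 p 0 p) a b.
    by rewrite /A !hE inv4_lc1 !inv4_lc2 (inv4C p p0); ring.
  have A4 a b i : (A a b)`_i.+2 = if i == 0%N then inv4 p0 p0 a b else 0.
    rewrite /A !coefD !coefCM !coefC coefX coefXn /= !eqSS.
    by case: (i == 0%N); rewrite /= ?mulr0 ?mulr1 ?addr0 ?add0r.
  clearbody A.
  pose F := A p p + 2%:R%:P * (A p0 p * 'X) + A p0 p0 * 'X^2.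
  pose G := A x x * A y y - A x y ^+ 2.
  have FE t : F.[t] = inv4 (lc t p0 1 p 0 p) (lc t p0 1 p 0 p)
                           (lc t p0 1 p 0 p) (lc t p0 1 p 0 p).
    rewrite /F !hE !AE inv4_lc3 !inv4_lc4.
    by rewrite (inv4C2 _ _ p p0); ring.
  have nzF : F != 0.
    apply: contraNneq nz0 => F0; have := coef0 K 4; rewrite -F0 /F.
    by rewrite !coefD coefCM coefMX coefMXn /= !A4 /= mulr0 !add0r => ->.
  have nzG : G != 0.
    apply: contraNneq nzm => G0; have := horner0 (0 : K); rewrite -G0 /G !hE !AE.
    by rewrite !inv4_lc1 !inv4_lc2 => <-; apply/eqP; ring.
  have /closed_nonrootP[t] : F * G != 0 by rewrite mulf_neq0.
  rewrite rootM negb_or /root => /andP[Ft Gt].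
  apply: none; exists (lc t p0 1 p 0 p); split; first by rewrite -FE.
  by exists x, y; rewrite -subr_eq0; move: Gt; rewrite /G !hE !AE.
(* Polarization of [sq], with y + z in place of y. *)
have sq3 p x y z : inv4 p p x x * inv4 p p y z = inv4 p p x y * inv4 p p x z.
  apply: (mulfI (nat_neq0 1)); have := sq p x (lc 1 y 1 z 0 x).
  rewrite inv4_lc3 !inv4_lc4 (inv4C2 _ _ z y) => E.
  transitivity (inv4 p p x x * (1 * (1 * inv4 p p y y + 1 * inv4 p p y z + 0 * inv4 p p y x) +
      1 * (1 * inv4 p p y z + 1 * inv4 p p z z + 0 * inv4 p p z x) +
      0 * (1 * inv4 p p x y + 1 * inv4 p p x z + 0 * inv4 p p x x))
      - inv4 p p x x * inv4 p p y y - inv4 p p x x * inv4 p p z z); first by ring.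
  by rewrite E !sq; ring.
(* Both sides are integrals by [integ_inv4_mul], with integrands equal by [sq3]. *)
have tot b c : inv4 p0 p0 b c = inv4 p0 b p0 c.
  by rewrite -integ_inv4_mul -(integ_inv4_mul p0 b); apply: eq_integ => p; apply: sq3.
have [b nzb [b0 _]] := exists_orthogonal3
  (inv4 p0 p0 p0 (1, 0, 0), inv4 p0 p0 p0 (0, 1, 0), inv4 p0 p0 p0 (0, 0, 1)) (0, 0, 0).
have {}b0 : inv4 p0 p0 p0 b = 0.
  have -> : b = lc b.1.1 (1, 0, 0) b.1.2 (0, 1, 0) b.2 (0, 0, 1).
    by case: b {nzb b0} => [[x y] z]; rewrite /lc /=; congr (_, _, _); ring.
  by rewrite inv4_lc4 -[RHS]b0 /dot /=; ring.
have ker c : inv4 p0 p0 p0 c = 0 -> inv4 p0 p0 b c = 0 /\ inv4 p0 p0 c c = 0.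
  move=> c0; split; apply: (mulfI nz0); rewrite mulr0.
    by rewrite sq3 b0 mul0r.
  by rewrite sq3 c0 mul0r.
have dec q (r : K) : q = lc 1 (lc 1 q (- r) p0 0 p0) r p0 0 p0.
  by case: q => [[x y] z]; rewrite /lc /=; congr (_, _, _); ring.
(* Split [c] into a multiple of [p0] and a part [c'] in the kernel of the linear form; [sq] at [c']
   kills the pure term, [tot] the others. *)
have p0b c : inv4 p0 b c c = 0.
  pose k := inv4 p0 p0 p0 c / inv4 p0 p0 p0 p0; pose c' := lc 1 c (- k) p0 0 p0.
  have c'0 : inv4 p0 p0 p0 c' = 0 by rewrite inv4_lc4 /k; field.
  have [bc' c'c'] := ker _ c'0.
  have -> : c = lc 1 c' k p0 0 p0 by apply: dec.
  have nbc' : inv4 p0 b c' c' = 0.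
    rewrite inv4_sym; apply/eqP; rewrite -sqrf_eq0 -sq (inv4_sym c' c' p0 p0) c'c'.
    by rewrite mul0r.
  clearbody c'.
  rewrite inv4_lc3 !inv4_lc4 nbc' (inv4C2 p0 b c' p0) -!tot.
  by rewrite bc' (inv4C2 p0 p0 b p0) b0; ring.
have /(qf_eq0 charK0) : forall c, qf (sym2 p0 b *m D) c = 0 by exact: p0b.
move/(congr1 (mulmx^~ C)); rewrite mulmxKV // mul0mx => p0b0.
have nzp0 : p0 != (0, 0, 0).
  apply: contra_neq nz0 => p00; have -> : p0 = lc 0 p0 0 p0 0 p0.
    by rewrite p00 /lc /=; congr (_, _, _); ring.
  by rewrite inv4_lc1; ring.
have E (i : 'I_6) : sym2 p0 b 0 i = 0 by rewrite p0b0 mxE.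
have Ek k (ltk : (k < 6)%N) := E (Ordinal ltk).
have sym_eq0 (x y : K) : (x + y) / 2%:R = 0 -> x + y = 0.
  by move/eqP; rewrite mulf_eq0 invr_eq0 (negbTE (nat_neq0 1)) orbF => /eqP.
move: (Ek 0%N isT) (Ek 1%N isT) (Ek 2%N isT) (Ek 3%N isT) (Ek 4%N isT) (Ek 5%N isT).
rewrite !mxE /= => E0 /sym_eq0 E1 /sym_eq0 E2 E3 /sym_eq0 E4 E5.
have prod0 (x y : K) : x != 0 -> x * y = 0 -> y = 0.
  by move=> nzx /eqP; rewrite mulf_eq0 (negbTE nzx) => /eqP.
case: p0 b nzp0 nzb E0 E1 E2 E3 E4 E5 {nz0 tot b0 ker dec p0b p0b0 E Ek} =>
  [[x y] z] [[x' y'] z'] /= nzp nzb E0 E1 E2 E3 E4 E5; case/eqP: nzb.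
(* The first nonzero coordinate of [p0] forces all coordinates of [b] to vanish. *)
have [x0 | nzx] := eqVneq x 0; last first.
  have x'0 := prod0 _ _ nzx E0; rewrite x'0 mulr0 addr0 in E1; rewrite x'0 mulr0 addr0 in E2.
  by rewrite x'0 (prod0 _ _ nzx E1) (prod0 _ _ nzx E2).
have [y0 | nzy] := eqVneq y 0; last first.
  have y'0 := prod0 _ _ nzy E3; rewrite y'0 mulr0 add0r in E1; rewrite y'0 mulr0 addr0 in E4.
  by rewrite y'0 (prod0 _ _ nzy E1) (prod0 _ _ nzy E4).
have nzz : z != 0 by apply: contra_neq nzp => ->; rewrite x0 y0.
have z'0 := prod0 _ _ nzz E5; rewrite z'0 mulr0 add0r in E2; rewrite z'0 mulr0 add0r in E4.
by rewrite z'0 (prod0 _ _ nzz E2) (prod0 _ _ nzz E4).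
Qed.

Lemma vrank_nondegenerate : vrank_le 7 s.
Proof.
(* With weight [- t] at [p], [Q] becomes apolar; any apolar [R] satisfies
   [R *m C = (t * qf R p) *: sym2 p p], so it is a multiple of [Q]. *)
have [p [nzp [x [y minor]]]] := exists_nonsquare.
pose t := (inv4 p p p p)^-1; pose Q := sym2 p p *m D.
have CQ R : integ s (fun q => qf Q q * qf R q) = qf R p.
  rewrite -catalecticantE mulmxKV // /qf /polar -[in LHS](trmxK (_ *m _)) mxE.
  by rewrite trmx_mul trmxK.
apply: (@vrank_le_cons _ 6 (- t, p)); apply: (@vrank_only_nonsquare _ Q).
- by apply: contraNneq nzp => Q0; rewrite -inv4_polar -/Q Q0 /polar mul0mx mxE.
- move=> a b; rewrite integ_cons /=.
  have -> : integ s (fun q => qf Q q * (dot a q * dot b q)) =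
      integ s (fun q => qf Q q * qf (prodform a b) q).
    by apply: eq_integ => q; rewrite (qf_prodform charK0).
  rewrite CQ (qf_prodform charK0) /qf inv4_polar /t.
  by field.
- move=> R apoR; exists (t * qf R p).
  have RC : R *m C = (t * qf R p) *: sym2 p p.
    apply: eq_row_dot => S; rewrite catalecticantE.
    have /kernel_apolar R0 := apoR.
    have := catalecticantE ((- t, p) :: s) R S; rewrite R0 mul0mx mxE integ_cons /= => E.
    rewrite -scalemxAl mxE.
    have -> : (sym2 p p *m S^T) 0 0 = qf S p.
      by rewrite /qf /polar -[in LHS](trmxK (_ *m _)) mxE trmx_mul trmxK.
    by rewrite -[LHS]subr0 E; ring.
  by rewrite -{1}(mulmxK uC R) RC /Q -scalemxAl.
by exists x, y.
Qed.

End Nondegenerate.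

Lemma vrank_le7 s : vrank_le 7 s.
Proof.
have [uC | ] := boolP (catalecticant s \in unitmx); first exact: vrank_nondegenerate.
rewrite -row_free_unit -kermx_eq0 => /rowV0Pn[Q /sub_kermxP Q0 nzQ].
exact: (vrank_apolar nzQ (apolar_kernel Q0)).
Qed.

End Catalecticant.

(** * The lower bound *)

Section LowerBound.
Variable K : closedFieldType.
Local Notation vec := (vec K).
Variable P : seq vec.
Hypothesis le_P6 : (size P <= 6)%N.

Let m i j k : K := \sum_(p <- P) p.1.1 ^+ i * p.1.2 ^+ j * p.2 ^+ k.

(** The moments of 6 x^2 y^2 + 4 y^3 z, with the multinomial factors 6 and 4 divided out. *)
Hypothesis mE : forall i j k, (i + j + k = 4)%N ->
  m i j k = ((i == 2) && (j == 2) || (j == 3) && (k == 1))%N%:R.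

Let sumE (G : vec -> K) i j k : (i + j + k = 4)%N ->
  (forall p, p \in P -> G p = p.1.1 ^+ i * p.1.2 ^+ j * p.2 ^+ k) ->
  \sum_(p <- P) G p = ((i == 2) && (j == 2) || (j == 3) && (k == 1))%N%:R.
Proof. by move=> /mE <- GE; apply: eq_big_seq. Qed.

(* z^2, xz and x^2 - yz span the conics apolar to the quartic. *)
Let conics (p : vec) := [:: p.2 ^+ 2; p.1.1 * p.2; p.1.1 ^+ 2 - p.1.2 * p.2].
Let expo (q : nat) : nat * nat * nat := nth (0, 0, 0)%N
  [:: (2, 0, 0); (1, 1, 0); (1, 0, 1); (0, 2, 0); (0, 1, 1); (0, 0, 2)]%N q.
Let quad (p : vec) q :=
  p.1.1 ^+ (expo q).1.1 * p.1.2 ^+ (expo q).1.2 * p.2 ^+ (expo q).2.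
Let pt (i : 'I_(size P)) := nth (0, 0, 0) P i.
Let N := \matrix_(g < 3, i < size P) nth 0 (conics (pt i)) g.
Let E := \matrix_(q < 6, i < size P) quad (pt i) q.

Let sum_pt (G : vec -> K) : \sum_i G (pt i) = \sum_(p <- P) G p.
Proof. by rewrite (big_nth (0, 0, 0)) big_mkord. Qed.

Let N_mul_E : N *m E^T = 0.
Proof.
apply/matrixP => g q; rewrite [RHS]mxE.
have entry (H : vec -> K) : (forall p, nth 0 (conics p) g * quad p q = H p) ->
    (N *m E^T) g q = \sum_(p <- P) H p.
  by move=> HE; rewrite mxE -sum_pt; apply: eq_bigr => i _; rewrite !mxE HE.
have q2 : ((expo q).1.1 + (expo q).1.2 + (expo q).2 = 2)%N.
  by case: q {entry} => [[|[|[|[|[|[|q]]]]]] ltq].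
case: g entry => [[|[|[|g]]] ltg] //= entry.
- rewrite (entry (fun p => p.1.1 ^+ (expo q).1.1 * p.1.2 ^+ (expo q).1.2 * p.2 ^+ (expo q).2.+2)).
    rewrite (sumE (i := (expo q).1.1) (j := (expo q).1.2) (k := (expo q).2.+2)) // ?addnS ?q2 //.
    by case: q {entry q2} => [[|[|[|[|[|[|q]]]]]] ltq].
  by move=> p; rewrite /quad !exprS; ring.
- rewrite (entry (fun p => p.1.1 ^+ (expo q).1.1.+1 * p.1.2 ^+ (expo q).1.2 * p.2 ^+ (expo q).2.+1)).
    rewrite (sumE (i := (expo q).1.1.+1) (j := (expo q).1.2) (k := (expo q).2.+1)) // ?addnS ?addSn ?q2 //.
    by case: q {entry q2} => [[|[|[|[|[|[|q]]]]]] ltq].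
  by move=> p; rewrite /quad !exprS; ring.
rewrite (entry (fun p => p.1.1 ^+ (expo q).1.1.+2 * p.1.2 ^+ (expo q).1.2 * p.2 ^+ (expo q).2
  - p.1.1 ^+ (expo q).1.1 * p.1.2 ^+ (expo q).1.2.+1 * p.2 ^+ (expo q).2.+1)).
  rewrite sumrB.
  rewrite (sumE (i := (expo q).1.1.+2) (j := (expo q).1.2) (k := (expo q).2)) // ?addnS ?addSn ?q2 //.
  rewrite (sumE (i := (expo q).1.1) (j := (expo q).1.2.+1) (k := (expo q).2.+1)) // ?addnS ?addSn ?q2 //.
  by case: q {entry q2} => [[|[|[|[|[|[|q]]]]]] ltq] //=; rewrite subrr.
by move=> p; rewrite /quad !exprS; ring.
Qed.

(** A conic [r] vanishing at all points satisfies [r *m E *m E^T = 0], so it is apolar. Solving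
    these equations makes it a combination [r'] of the three conics, and [r' *m N = 0]. *)
Let E_free : row_free N -> row_free E.
Proof.
move=> freeN; rewrite -kermx_eq0; apply/rowV0P => r /sub_kermxP rE0.
have rEE (q : 'I_6) : \sum_q' r 0 q' * (\sum_(p <- P) quad p q' * quad p q) = 0.
  transitivity ((r *m E *m E^T) 0 q); last by rewrite rE0 mul0mx mxE.
  rewrite -mulmxA mxE; apply: eq_bigr => q' _; congr (_ * _); rewrite mxE -sum_pt.
  by apply: eq_bigr => i _; rewrite !mxE.
have sumqE (q q' : 'I_6) : \sum_(p <- P) quad p q' * quad p q =
    (((expo q').1.1 + (expo q).1.1 == 2) && ((expo q').1.2 + (expo q).1.2 == 2) ||
     ((expo q').1.2 + (expo q).1.2 == 3) && ((expo q').2 + (expo q).2 == 1))%N%:R.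
  apply: sumE; last by move=> p _; rewrite /quad !exprD; ring.
  case: q => [[|[|[|[|[|[|q]]]]]] ltq] //; by case: q' => [[|[|[|[|[|[|q']]]]]] ltq'].
have o1 : lift ord0 ord0 = @Ordinal 6 1 isT by apply: val_inj.
have o2 : lift ord0 (lift ord0 ord0) = @Ordinal 6 2 isT by apply: val_inj.
have o3 : lift ord0 (lift ord0 (lift ord0 ord0)) = @Ordinal 6 3 isT by apply: val_inj.
have o4 : lift ord0 (lift ord0 (lift ord0 (lift ord0 ord0))) = @Ordinal 6 4 isT by apply: val_inj.
have o5 : lift ord0 (lift ord0 (lift ord0 (lift ord0 (lift ord0 ord0)))) = @Ordinal 6 5 isT
  by apply: val_inj.
have o0 : ord0 = @Ordinal 6 0 isT by apply: val_inj.
have os := (o5, o4, o3, o2, o1).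
have r3 : r 0 (@Ordinal 6 3 isT) = 0.
  rewrite -[RHS](rEE (@Ordinal 6 0 isT)) !big_ord_recl big_ord0 !sumqE /=.
  by rewrite !os o0; ring.
have r1 : r 0 (@Ordinal 6 1 isT) = 0.
  rewrite -[RHS](rEE (@Ordinal 6 1 isT)) !big_ord_recl big_ord0 !sumqE /=.
  by rewrite !os o0; ring.
have r4 : r 0 (@Ordinal 6 4 isT) = - r 0 (@Ordinal 6 0 isT).
  apply/eqP; rewrite -addr_eq0; apply/eqP.
  rewrite -[RHS](rEE (@Ordinal 6 3 isT)) !big_ord_recl big_ord0 !sumqE /=.
  by rewrite !os o0; ring.
pose r' : 'rV_3 := \row_g nth 0 [:: r 0 (@Ordinal 6 5 isT); r 0 (@Ordinal 6 2 isT);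
                                   r 0 (@Ordinal 6 0 isT)] g.
have /eqP : r' *m N = 0.
  rewrite -rE0; apply/rowP => i; rewrite !mxE !big_ord_recl !big_ord0 !mxE /= /quad /=.
  by rewrite !os o0 r1 r3 r4; ring.
rewrite (mulmx_free_eq0 _ freeN) => /eqP/rowP r'0.
have rk0 k (ltk : (k < 3)%N) : nth 0 [:: r 0 (@Ordinal 6 5 isT); r 0 (@Ordinal 6 2 isT);
    r 0 (@Ordinal 6 0 isT)] k = 0 by have := r'0 (Ordinal ltk); rewrite !mxE.
have r5 := rk0 0%N isT; have r2 := rk0 1%N isT; have r0 := rk0 2%N isT; rewrite /= in r5 r2 r0.
apply/rowP => i; rewrite mxE; case: i => [[|[|[|[|[|[|i]]]]]] lti] //.
- by rewrite -r0; congr (r 0 _); apply: val_inj.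
- by rewrite -r1; congr (r 0 _); apply: val_inj.
- by rewrite -r2; congr (r 0 _); apply: val_inj.
- by rewrite -r3; congr (r 0 _); apply: val_inj.
- by rewrite -[RHS]oppr0 -r0 -r4; congr (r 0 _); apply: val_inj.
by rewrite -r5; congr (r 0 _); apply: val_inj.
Qed.

(** Otherwise [N] and [E] have ranks 3 and 6, while by [N_mul_E] these add up to at most the number
    of points. *)
Lemma conics_dependent : exists al be ga : K, (al, be, ga) != (0, 0, 0) /\
  forall p, p \in P ->
    al * p.2 ^+ 2 + be * (p.1.1 * p.2) + ga * (p.1.1 ^+ 2 - p.1.2 * p.2) = 0.
Proof.
have [freeN | ] := boolP (row_free N).
  have := leq_trans (mulmx0_rank_max N_mul_E) le_P6.
  by rewrite mxrank_tr (eqP freeN) (eqP (E_free freeN)).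
rewrite -kermx_eq0 => /rowV0Pn[r /sub_kermxP rN0 nzr].
have i1 : lift ord0 ord0 = 1 :> 'I_3 by apply: val_inj.
have i2 : lift ord0 (lift ord0 ord0) = 2%:R :> 'I_3 by apply: val_inj.
exists (r 0 0), (r 0 1), (r 0 2%:R); split.
  apply: contraNneq nzr => -[c0 c1 c2]; apply/eqP/rowP => i; rewrite mxE.
  by case: i => [[|[|[|i]]] lti] //; [rewrite -c0 | rewrite -c1 | rewrite -c2];
    congr (r 0 _); apply: val_inj.
move=> p Pp; have ltp : (index p P < size P)%N by rewrite index_mem.
have /matrixP/(_ 0 (Ordinal ltp)) := rN0.
rewrite !mxE !big_ord_recl big_ord0 !mxE /= i1 i2 /pt /= nth_index // => E0.
by rewrite -[RHS]E0; ring.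
Qed.

Lemma no_decomposition_of_size6 : False.
Proof.
have [al [be [ga [nz conicP]]]] := conics_dependent.
have [ga0 | nzga] := eqVneq ga 0; last first.
  pose b := be / ga; pose a := al / ga.
  have xx p : p \in P -> p.1.1 ^+ 2 = p.1.2 * p.2 - b * (p.1.1 * p.2) - a * p.2 ^+ 2.
    move=> /conicP E0; apply/eqP; rewrite -subr_eq0; apply/eqP.
    by rewrite -[RHS](mulr0 ga^-1) -E0 /a /b; field.
  (* On the conic y / z = (x / z)^2 + b (x / z) + a, so these power sums up to 6 are combinations of
     moments. Points with z = 0 have x = 0; their weights and the monomials used vanish alike. *)
  pose t := [seq (p.2 ^+ 4, p.1.1 / p.2) | p <- P].
  have tE i : psum t i = \sum_(p <- P) p.2 ^+ 4 * (p.1.1 / p.2) ^+ i.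
    by rewrite /psum big_map.
  have x0 p : p \in P -> p.2 = 0 -> p.1.1 = 0.
    move=> /xx xxp p20; apply/eqP; rewrite -sqrf_eq0 xxp p20; apply/eqP; ring.
  have low i : (i <= 4)%N -> psum t i = 0.
    move=> le_i4; rewrite tE (sumE (i := i) (j := 0) (k := 4 - i)) ?addn0 ?subnKC //.
      by rewrite andbF.
    move=> p Pp; have [p20 | nzp2] := eqVneq p.2 0; last first.
      by rewrite mulr1 expr_div_n mulrCA expfB_cond // (negbTE nzp2).
    rewrite p20 (x0 p) // expr0n /= !mul0r mulr1 -exprD subnKC //.
    by rewrite expr0n.
  have t5 : psum t 5 = 0.
    rewrite tE (eq_big_seq (fun p => p.1.1 ^+ 3 * p.1.2 ^+ 1 * p.2 ^+ 0 +
      ((- b) * (p.1.1 ^+ 4 * p.1.2 ^+ 0 * p.2 ^+ 0) + (- a) * (p.1.1 ^+ 3 * p.1.2 ^+ 0 * p.2 ^+ 1)))).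
      rewrite !big_split -!mulr_sumr /= -!/(m _ _ _) !mE //=; ring.
    move=> p Pp; have [p20 | nzp2] := eqVneq p.2 0.
      by rewrite p20 (x0 p) //; ring.
    apply: (mulIf nzp2); transitivity (p.1.1 ^+ 3 * p.1.1 ^+ 2); first by field.
    by rewrite xx //; ring.
  have t6 : psum t 6 = 1.
    rewrite tE (eq_big_seq (fun p => p.1.1 ^+ 2 * p.1.2 ^+ 2 * p.2 ^+ 0 +
      ((- 2%:R * b) * (p.1.1 ^+ 3 * p.1.2 ^+ 1 * p.2 ^+ 0) +
      ((- 2%:R * a) * (p.1.1 ^+ 2 * p.1.2 ^+ 1 * p.2 ^+ 1) +
      (b ^+ 2 * (p.1.1 ^+ 4 * p.1.2 ^+ 0 * p.2 ^+ 0) +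
      (2%:R * a * b * (p.1.1 ^+ 3 * p.1.2 ^+ 0 * p.2 ^+ 1) +
      a ^+ 2 * (p.1.1 ^+ 2 * p.1.2 ^+ 0 * p.2 ^+ 2))))))).
      rewrite !big_split -!mulr_sumr /= -!/(m _ _ _) !mE //=; ring.
    move=> p Pp; have [p20 | nzp2] := eqVneq p.2 0.
      by rewrite p20 (x0 p) //; ring.
    apply: (mulIf (expf_neq0 2 nzp2)).
    transitivity (p.1.1 ^+ 2 * (p.1.1 ^+ 2) ^+ 2); first by field.
    by rewrite {2}xx //; ring.
  have := @psum_vanish K 6 t; rewrite t6 size_map => /(_ le_P6) => E1.
  case/eqP: (oner_neq0 K); apply: E1 => -[|[|[|[|[|[|i]]]]]] // _; exact: low.
have [be0 | nzbe] := eqVneq be 0.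
  have nzal : al != 0 by apply: contra_neq nz => ->; rewrite be0 ga0.
  have z0 p : p \in P -> p.2 = 0.
    move=> /conicP; rewrite be0 ga0 !mul0r !addr0 => /eqP.
    by rewrite mulf_eq0 (negbTE nzal) sqrf_eq0 => /eqP.
  have := mE (i := 0) (j := 3) (k := 1) erefl; rewrite /m big_seq big1 => [/eqP|p /z0->].
    by rewrite eq_sym oner_eq0.
  by rewrite expr1 mulr0.
pose t := - (al / be).
have xz p : p \in P -> p.2 != 0 -> p.1.1 = t * p.2.
  move=> /conicP E0 nzp2; apply: (mulIf nzp2); apply: (mulfI nzbe); apply/eqP.
  by rewrite -subr_eq0 -E0 ga0 /t; apply/eqP; field.
(* The conic is the pair of lines z = 0 and x = t z. The points off z = 0 have power sums 0, 0, 0,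
   1, so there are at least four; those on it have 0, 0, 1, so there are at least three. *)
pose PA := [seq p <- P | p.2 != 0]; pose PB := [seq p <- P | p.2 == 0].
pose tA := [seq (p.2 ^+ 4, p.1.2 / p.2) | p <- PA].
pose tB := [seq (p.1.1 ^+ 4, p.1.2 / p.1.1) | p <- PB].
have tAE j : (j <= 3)%N -> psum tA j = (j == 3)%:R.
  move=> le_j3; rewrite /psum big_map big_filter /= big_mkcond.
  rewrite (sumE (i := 0) (j := j) (k := 4 - j)) ?add0n ?subnKC ?(leq_trans le_j3) //.
    by move: j le_j3 => [|[|[|[|j]]]].
  move=> p _; have [-> | nzp2] /= := eqVneq p.2 0.
    by rewrite expr0n subn_eq0 leqNgt ltnS le_j3 mulr0.
  rewrite mul1r expr_div_n mulrCA -expfB_cond ?(negbTE nzp2) //.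
  by rewrite (leq_trans le_j3).
have tBE j : (j <= 2)%N -> psum tB j = (j == 2)%:R.
  move=> le_j2; rewrite /psum big_map big_filter /= big_mkcond.
  (* The contribution of the points off z = 0 is subtracted, using x = t z there. *)
  rewrite (eq_big_seq (fun p => p.1.1 ^+ (4 - j) * p.1.2 ^+ j * p.2 ^+ 0 +
     (- t ^+ (4 - j)) * (p.1.1 ^+ 0 * p.1.2 ^+ j * p.2 ^+ (4 - j)))).
    rewrite big_split -mulr_sumr /= -!/(m _ _ _).
    by move: j le_j2 => [|[|[|j]]] // _; rewrite !mE //=; ring.
  move=> p Pp; have [p20 | nzp2] := eqVneq p.2 0.
    rewrite p20; have -> : (0 : K) ^+ (4 - j) = 0 by rewrite expr0n subn_eq0 leqNgt (leq_ltn_trans le_j2).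
    rewrite !mulr0 addr0 mulr1; have [p10 | nzp1] := eqVneq p.1.1 0.
      by rewrite p10 !expr0n subn_eq0 leqNgt (leq_ltn_trans le_j2) //= !mul0r.
    rewrite expr_div_n mulrCA -expfB_cond ?(negbTE nzp1) ?(leq_trans le_j2) //.
    by rewrite mulrC.
  by rewrite xz // exprMn; ring.
have : (size tA + size tB <= 6)%N.
  by rewrite !size_map !size_filter addnC count_predC.
have [leA _ | ltA leAB] := leqP (size tA) 3.
  have := @psum_vanish K 3 tA leA; rewrite tAE // => E1; case/eqP: (oner_neq0 K); apply: E1.
  by move=> i lti; rewrite tAE ?(ltnW lti) // ltn_eqF.
have leB : (size tB <= 2)%N by rewrite -(leq_add2l 4) (leq_trans _ leAB) // leq_add2r.
have := @psum_vanish K 2 tB leB; rewrite tBE // => E1; case/eqP: (oner_neq0 K); apply: E1.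
by move=> i lti; rewrite tBE ?(ltnW lti) // ltn_eqF.
Qed.

End LowerBound.

(** * Homogeneous polynomials *)

Section WaringRank.
Variable K : closedFieldType.
Hypothesis charK0 : [pchar K] =i pred0.
Local Notation vec := (vec K).
Local Notation poly3 := {mpoly K[3]}.
Implicit Types (s t : seq (K * vec)) (p a b c d : vec) (f g l : poly3).

Let nat_neq0 := natK_neq0 charK0.

Definition linform p : poly3 :=
  p.1.1 *: 'X_(@Ordinal 3 0 isT) + p.1.2 *: 'X_(@Ordinal 3 1 isT) + p.2 *: 'X_(@Ordinal 3 2 isT).

Definition qpoly s : poly3 := \sum_(x <- s) x.1 *: linform x.2 ^+ 4.

Lemma polarization4 (R : comNzRingType) (a b c d : R) :
  24%:R * (a * b * c * d) =
    (a + b + c + d) ^+ 4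
    - (a + b + c) ^+ 4 - (a + b + d) ^+ 4 - (a + c + d) ^+ 4 - (b + c + d) ^+ 4
    + (a + b) ^+ 4 + (a + c) ^+ 4 + (a + d) ^+ 4 + (b + c) ^+ 4 + (b + d) ^+ 4
    + (c + d) ^+ 4 - a ^+ 4 - b ^+ 4 - c ^+ 4 - d ^+ 4.
Proof. by ring. Qed.

Lemma linformD a b : linform (a + b) = linform a + linform b.
Proof. by rewrite /linform /= !scalerDl; ring. Qed.

Lemma linform_homog p : linform p \is 1.-homog.
Proof. by rewrite /linform !rpredD // rpredZ // dhomogX /= mdeg1. Qed.

Lemma qpoly_cat s t : qpoly (s ++ t) = qpoly s + qpoly t.
Proof. exact: big_cat. Qed.

Lemma qpoly_scale x s : qpoly [seq (x * y.1, y.2) | y <- s] = x *: qpoly s.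
Proof. by rewrite /qpoly big_map scaler_sumr; apply: eq_bigr => y _; rewrite scalerA. Qed.

Lemma qpoly_prod4 a b c d :
  exists s, linform a * linform b * linform c * linform d = qpoly s.
Proof.
exists [seq (24%:R^-1 * x.1, x.2) | x <- [:: (1, a + b + c + d);
  (-1, a + b + c); (-1, a + b + d); (-1, a + c + d); (-1, b + c + d);
  (1, a + b); (1, a + c); (1, a + d); (1, b + c); (1, b + d); (1, c + d);
  (-1, a); (-1, b); (-1, c); (-1, d)]].
rewrite qpoly_scale; apply: (scalerI (nat_neq0 23)).
rewrite scalerA divff // scale1r scaler_nat -mulr_natl polarization4.
rewrite /qpoly !big_cons big_nil /= !linformD !scale1r !scaleN1r; ring.
Qed.

(** A monomial of degree 4 is a product of four variables, which polarization turns into fourth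
    powers. *)
Lemma qpoly_of_homog f : f \is 4.-homog -> exists s, f = qpoly s.
Proof.
move=> homf; rewrite [f]mpolyE big_seq.
apply: (big_ind (fun g => exists s, g = qpoly s)).
- by exists [::]; rewrite /qpoly big_nil.
- by move=> g1 g2 [s1 ->] [s2 ->]; exists (s1 ++ s2); rewrite qpoly_cat.
move=> m /(dhomog_mf homf) /= degm.
suff [s sE] : exists s, 'X_[m] = qpoly s.
  by exists [seq (f@_m * y.1, y.2) | y <- s]; rewrite qpoly_scale sE.
pose e (i : 'I_3) : vec := nth 0 [:: (1, 0, 0); (0, 1, 0); (0, 0, 1)] i.
have linE i : linform (e i) = 'X_i.
  case: i => [[|[|[|i]]] lti] //; rewrite /linform /= ?scale0r ?scale1r ?addr0 ?add0r;
    congr 'X_ _; exact: val_inj.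
pose r := flatten [seq nseq (m i) i | i <- enum 'I_3].
have rE : 'X_[m] = \prod_(i <- r) linform (e i).
  rewrite mpolyXE_id big_flatten /= big_map big_enum /=; apply: eq_bigr => i _.
  by rewrite big_nseq iter_mulr_1 linE.
have szr : size r = 4%N.
  rewrite size_flatten /shape -map_comp sumnE big_map big_enum /=.
  by rewrite -[RHS]degm mdegE; apply: eq_bigr => i _ /=; rewrite size_nseq.
rewrite rE; case: r szr {rE} => [|i [|j [|k [|l [|? ?]]]]] //= _.
by rewrite !big_cons big_nil mulr1 !mulrA; apply: qpoly_prod4.
Qed.

Lemma linform_of_homog l : l \is 1.-homog -> exists p, l = linform p.
Proof.
move=> homl; rewrite [l]mpolyE big_seq.
apply: (big_ind (fun g => exists p, g = linform p)).
- by exists 0; rewrite /linform /= !scale0r !addr0.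
- by move=> g1 g2 [p1 ->] [p2 ->]; exists (p1 + p2); rewrite linformD.
move=> m /(dhomog_mf homl) /= /eqP; rewrite mdeg_eq1 => /existsP[i /eqP->].
exists (l@_U_(i) * (i == 0 :> nat)%N%:R, l@_U_(i) * (i == 1 :> nat)%N%:R, l@_U_(i) * (i == 2 :> nat)%N%:R).
case: i => [[|[|[|i]]] lti] //; rewrite /linform /= ?mulr1 ?mulr0 ?scale0r ?addr0 ?add0r;
  congr (_@_U_(_) *: 'X_ _); exact: val_inj.
Qed.

Definition point p : 'I_3 -> K := fun i => nth 0 [:: p.1.1; p.1.2; p.2] i.

Lemma meval_linform p a : (linform p).@[point a] = dot a p.
Proof. by rewrite /linform !mevalD !mevalZ !mevalXU /point /= /dot; ring. Qed.

Lemma meval_qpoly s a : (qpoly s).@[point a] = integ s (fun p => dot a p ^+ 4).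
Proof.
rewrite /qpoly raddf_sum /integ; apply: eq_bigr => x _ /=.
by rewrite mevalZ rmorphXn /= meval_linform.
Qed.


Lemma integ_prod4 s a b c d :
  24%:R * integ s (fun p => dot a p * dot b p * dot c p * dot d p) =
  \sum_(x <- [:: (1, a + b + c + d);
    (-1, a + b + c); (-1, a + b + d); (-1, a + c + d); (-1, b + c + d);
    (1, a + b); (1, a + c); (1, a + d); (1, b + c); (1, b + d); (1, c + d);
    (-1, a); (-1, b); (-1, c); (-1, d)])
    x.1 * integ s (fun p => dot x.2 p ^+ 4).
Proof.
have dotD (e e' : vec) p : dot (e + e') p = dot e p + dot e' p by rewrite /dot /=; ring.
rewrite -integZ !big_cons big_nil /= addr0 -!integZ -!integD; apply: eq_integ => p.
by rewrite polarization4 !dotD; ring.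
Qed.

Definition coordmom s := mom s (fun p => p.1.1) (fun p => p.1.2) (fun p => p.2).

Definition monovec i j k n : vec :=
  nth 0 (nseq i (1, 0, 0) ++ nseq j (0, 1, 0) ++ nseq k (0, 0, 1)) n.

Lemma coordmom_prod4 s i j k : (i + j + k = 4)%N -> coordmom s i j k =
  integ s (fun p => dot (monovec i j k 0) p * dot (monovec i j k 1) p *
                    dot (monovec i j k 2) p * dot (monovec i j k 3) p).
Proof.
by move: i j k; apply: monomials4; apply: eq_integ => p; rewrite /monovec /dot /=; ring.
Qed.

(** A moment is the contraction with a product of four linear forms, which polarization expresses
    through values of the quartic. *)
Lemma eq_coordmom s t :
    (forall L, integ s (fun p => dot L p ^+ 4) = integ t (fun p => dot L p ^+ 4)) ->
  forall i j k, (i + j + k = 4)%N -> coordmom s i j k = coordmom t i j k.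
Proof.
move=> st i j k ijk; rewrite !coordmom_prod4 //; apply: (mulfI (nat_neq0 23)); rewrite !integ_prod4.
by apply: eq_bigr => x _; rewrite st.
Qed.

Lemma qpoly_coordmom s t :
    (forall i j k, (i + j + k = 4)%N -> coordmom s i j k = coordmom t i j k) ->
  qpoly s = qpoly t.
Proof.
pose M s i j k := (coordmom s i j k)%:MP_[3].
set x : poly3 := 'X_(@Ordinal 3 0 isT); set y : poly3 := 'X_(@Ordinal 3 1 isT).
set z : poly3 := 'X_(@Ordinal 3 2 isT).
have qE r : qpoly r = x ^+ 4 * M r 4%N 0%N 0%N + 4%:R * x ^+ 3 * y * M r 3%N 1%N 0%N
  + 4%:R * x ^+ 3 * z * M r 3%N 0%N 1%N
  + 6%:R * x ^+ 2 * y ^+ 2 * M r 2%N 2%N 0%N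
  + 12%:R * x ^+ 2 * y * z * M r 2%N 1%N 1%N
  + 6%:R * x ^+ 2 * z ^+ 2 * M r 2%N 0%N 2%N
  + 4%:R * x * y ^+ 3 * M r 1%N 3%N 0%N
  + 12%:R * x * y ^+ 2 * z * M r 1%N 2%N 1%N
  + 12%:R * x * y * z ^+ 2 * M r 1%N 1%N 2%N
  + 4%:R * x * z ^+ 3 * M r 1%N 0%N 3%N
  + y ^+ 4 * M r 0%N 4%N 0%N + 4%:R * y ^+ 3 * z * M r 0%N 3%N 1%N
  + 6%:R * y ^+ 2 * z ^+ 2 * M r 0%N 2%N 2%N
  + 4%:R * y * z ^+ 3 * M r 0%N 1%N 3%N + z ^+ 4 * M r 0%N 0%N 4%N.
  rewrite /M /coordmom /mom /qpoly.
  elim: r => [|c r IH]; first by rewrite /integ !big_nil mpolyC0; ring.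
  rewrite !integ_cons big_cons IH /linform -/x -/y -/z -!mul_mpolyC.
  by ring.
by move=> st; rewrite !qE /M !st.
Qed.

(** A fourth root of each weight is absorbed into its linear form. *)
Lemma sum_of_powers_qpoly t : sum_of_powers 4 (size t) (qpoly t).
Proof.
elim: t => [|x t [l [homl tE]]].
  by exists (fun=> 0); split=> [i|]; rewrite ?rpred0 // /qpoly big_nil big_ord0.
have [r rE] := @GRing.solve_monicpoly K 4 (fun i => if i == 0%N then x.1 else 0) isT.
have {}rE : r ^+ 4 = x.1 by rewrite rE !big_ord_recl big_ord0 /= expr0; ring.
exists (fun i => if unlift ord0 i is Some j then l j else r *: linform x.2); split.
  by move=> i; case: unliftP => [j|] _; [exact: homl | rewrite rpredZ // linform_homog].
rewrite /qpoly big_cons -/(qpoly t) tE big_ord_recl unlift_none exprZn rE.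
by congr (_ + _); apply: eq_bigr => i _; rewrite liftK.
Qed.

Lemma sum_of_powers_widen (F : fieldType) (n d r r' : nat) (g : {mpoly F[n]}) :
  (r <= r')%N -> (0 < d)%N -> sum_of_powers d r g -> sum_of_powers d r' g.
Proof.
move=> le_rr' d_gt0 [l [homl ->]].
exists (fun i : 'I_r' => if insub (i : nat) is Some j then l j else 0); split.
  by move=> i; case: insubP => [j _ _|_]; rewrite ?homl ?rpred0.
rewrite -(subnKC le_rr') big_split_ord /= [X in _ = _ + X]big1 ?addr0 => [|i _].
  apply: eq_bigr => i _; case: insubP => [j _ jE | ]; last by rewrite /= ltn_ord.
  by congr (l _ ^+ _); apply: val_inj; rewrite jE.
by rewrite insubF ?expr0n ?gtn_eqF //= ltnNge leq_addr.
Qed.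

Lemma sum_of_seven_powers f : f \is 4.-homog -> sum_of_powers 4 7 f.
Proof.
case/qpoly_of_homog => s ->; have [t le_t7 st] := vrank_le7 charK0 s.
rewrite (qpoly_coordmom (eq_coordmom st)).
by apply: sum_of_powers_widen (sum_of_powers_qpoly t).
Qed.

(* On dual quartics restricted to the apolar conic (t, t^2, 1), this quartic
   acts by extracting the coefficient of t^6. *)
Definition rank7_quartic : poly3 :=
  4%:R *: ('X_(@Ordinal 3 1 isT) ^+ 3 * 'X_(@Ordinal 3 2 isT)) +
  6%:R *: ('X_(@Ordinal 3 0 isT) ^+ 2 * 'X_(@Ordinal 3 1 isT) ^+ 2).

Lemma rank7_quartic_homog : rank7_quartic \is 4.-homog.
Proof.
have hX i : ('X_i : poly3) \is 1.-homog by rewrite dhomogX /= mdeg1.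
rewrite rpredD // rpredZ //.
  exact: (dhomogM (dhomogMn 3 (hX _)) (hX _)).
exact: (dhomogM (dhomogMn 2 (hX _)) (dhomogMn 2 (hX _))).
Qed.

Lemma rank7_quartic_rank r : sum_of_powers 4 r rank7_quartic -> (7 <= r)%N.
Proof.
move=> [l [homl lE]]; rewrite leqNgt; apply/negP => lt_r7.
have [pts lpts] : exists pts : 'I_r -> vec, forall i, l i = linform (pts i).
  have pP i : {p : vec | l i == linform p}.
    apply: sigW; have [p ->] := linform_of_homog (homl i); exists p; exact: eqxx.
  by exists (fun i => sval (pP i)) => i; apply/eqP; exact: svalP (pP i).
pose P := [seq pts i | i <- enum 'I_r].
have szP : (size P <= 6)%N by rewrite size_map size_enum_ord -ltnS.
pose s := [seq (1 : K, p) | p <- P].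
have fE : rank7_quartic = qpoly s.
  rewrite lE /qpoly /s /P 2!big_map big_enum /=; apply: eq_bigr => i _.
  by rewrite scale1r lpts.
(* Both expressions of the quartic are evaluated at [a]; polarization then yields the moments. *)
have sE a : integ s (fun p => dot a p ^+ 4) =
    4%:R * (a.1.2 ^+ 3 * a.2) + 6%:R * (a.1.1 ^+ 2 * a.1.2 ^+ 2).
  rewrite -meval_qpoly -fE /rank7_quartic mevalD !mevalZ.
  have mE g h i j : (g ^+ i * h ^+ j).@[point a] = g.@[point a] ^+ i * h.@[point a] ^+ j.
    by rewrite mevalM !rmorphXn.
  by rewrite (mE _ _ 3%N 1%N) (mE _ _ 2%N 2%N) !mevalXU.
apply: (@no_decomposition_of_size6 K P szP) => i j k ijk.
have -> : \sum_(p <- P) p.1.1 ^+ i * p.1.2 ^+ j * p.2 ^+ k = coordmom s i j k.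
  by rewrite /coordmom /mom /integ [RHS]big_map; apply: eq_bigr => p _; rewrite mul1r.
move: i j k ijk; apply: monomials4; rewrite coordmom_prod4 //;
  apply: (mulfI (nat_neq0 23)); rewrite integ_prod4 !big_cons big_nil !sE /monovec /=; ring.
Qed.


End WaringRank.

(** Well-ordering for a predicate that need not be decidable, by classical logic. *)
Lemma minimal_nat (P : nat -> Prop) n : P n ->
  exists r, [/\ P r, (r <= n)%N & forall s, P s -> (r <= s)%N].
Proof.
elim/ltn_ind: n => n IHn Pn.
have [[s [lt_sn Ps]] | minn] := classic (exists s, (s < n)%N /\ P s).
  by have [r [Pr le_rs minr]] := IHn s lt_sn Ps; exists r; split=> //;
    rewrite (leq_trans le_rs) // ltnW.
exists n; split=> // s Ps; rewrite leqNgt; apply/negP => lt_sn.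
by apply: minn; exists s.
Qed.

Theorem mainTheorem1 (K : closedFieldType) (charK0 : [pchar K] =i pred0) :
  (forall f : {mpoly K[3]}, f \is 4.-homog ->
     exists r : nat, waring_rank 4 f r /\ (r <= 7)%N) /\
  (exists f : {mpoly K[3]}, f \is 4.-homog /\ waring_rank 4 f 7).
Proof.
split=> [f homf | ].
  have [r [fr le_r7 minr]] := @minimal_nat (fun r => sum_of_powers 4 r f) 7
    (sum_of_seven_powers charK0 homf).
  by exists r; split.
exists (rank7_quartic K); split; first exact: rank7_quartic_homog.
split; first exact: sum_of_seven_powers (rank7_quartic_homog K).
by move=> s; apply: rank7_quartic_rank.
Qed.
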